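(* For any $\varepsilon>0$ there exists $d_0=d_0(\varepsilon)\ge1$ such that for all $d\ge d_0$ and $0<\beta\le(1-\varepsilon)\beta_c(d)$ the following holds. Let $\ell=r=\frac{\log n}{\sqrt d}$, let $P=(v_0,\dots,v_\ell)$ be an $(\ell+1)$-tuple of vertices, and let $(\mathbf T,\beta,\{\mathbf J_e\})$ be the random tree construction with respect to $P,n,d,r,\beta$. Let $\mathcal E^{\rm left}_{\mathbf T}$ (resp. $\mathcal E^{\rm right}_{\mathbf T}$) be the event that $P$ contains fewer than $\frac{7}{10}\ell$ vertices that are $(d,\varepsilon)$-left-block (resp. right-block) vertices with respect to $P$ in $\mathbf T$. Then $\Pr[\mathcal E^{\rm left}_{\mathbf T}]\le n^{-d^{1/6}}$ and $\Pr[\mathcal E^{\rm right}_{\mathbf T}]\le n^{-d^{1/6}}$.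
   Context: $\beta_c(k)=\sqrt{2\pi}/k$. Random tree construction: from $v_0,\dots,v_\ell$, add edges $\{v_{i-1},v_i\}$; from each $v_i$ hang an independent Galton–Watson tree with offspring distribution $\mathrm{Binom}(n,d/n)$, truncated at depth $r$; give every edge $e$ of the resulting tree $\mathbf T$ an independent standard Gaussian coupling $\mathbf J_e$. In $\mathbf T$: $\Gamma_e=\frac{|1-\exp(\beta\mathbf J_e)|}{1+\exp(\beta\mathbf J_e)}$; $\mathcal A(u)=\sum_{w\sim u}\Gamma_{\{u,w\}}$ (neighbours in $\mathbf T$); $M(u)=1-\varepsilon/4$ if $\mathcal A(u)\le1-\varepsilon/2$, else $d\,\mathcal A(u)$; $M(Q)=\prod_{v\in Q}M(v)$ for a path $Q$ (length = number of edges). For $i\in\{0,\dots,\ell\}$, $W_P(v_i)=\max_Q M(Q)$ over all paths $Q$ in $\mathbf T$ of length at most $r$ starting at $v_i$ and sharing no vertex with $P$ other than $v_i$. $v_j$ is a $(d,\varepsilon)$-left-block vertex w.r.t. $P$ if $\prod_{k=t}^jW_P(v_k)<1$ for all $t\le j$, and a $(d,\varepsilon)$-right-block vertex w.r.t. $P$ if $\prod_{k=j}^tW_P(v_k)<1$ for all $t\ge j$ ($t\le\ell$). *)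

(* Defs.v *)
From HB Require Import structures.
From mathcomp Require Import all_boot all_order all_algebra.
From mathcomp Require Import all_classical all_reals all_analysis.

Set Implicit Arguments.
Unset Strict Implicit.
Unset Printing Implicit Defensive.

Import Order.TTheory GRing.Theory Num.Theory.
Import numFieldNormedType.Exports.

Local Open Scope classical_set_scope.
Local Open Scope ring_scope.

Definition beta_c (R : realType) (k : R) : R := Num.sqrt (2 * pi) / k.

(* Notions attached to a finite graph [adj] whose edges {u, w} carry couplings
   [J [set u; w]], and to a tuple of vertices P = (v 0, ..., v l). *)
Section BlockVertices.
Variables (R : realType) (V : finType).
Variables (d eps beta : R) (adj : rel V) (J : {set V} -> R).

Definition Gamma (e : {set V}) : R :=
  `|1 - expR (beta * J e)| / (1 + expR (beta * J e)).

Definition calA (u : V) : R :=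
  \sum_(w : V | adj u w) Gamma [set u; w]%SET.

Definition vweight (u : V) : R :=
  if calA u <= 1 - eps / 2 then 1 - eps / 4 else d * calA u.

Definition pweight (Q : seq V) : R := \prod_(u <- Q) vweight u.

Variables (l r : nat) (v : 'I_l.+1 -> V).

(* [x :: p] is a path of length [size p] meeting P at most in its start x. *)
Definition offpath (x : V) (p : seq V) : bool :=
  [&& path adj x p, uniq (x :: p) & all [predC codom v] p].

(* The default value of the maximum is the weight of the path of length 0,
   which is always admissible. *)
Definition Wmax (i : 'I_l.+1) : R :=
  \big[Num.max/pweight [:: v i]]_(p : {bseq r of V} | offpath (v i) p)
    pweight (v i :: p).

Definition left_block (j : 'I_l.+1) : bool :=
  [forall t : 'I_l.+1, (t <= j)%N ==>
    (\prod_(k < l.+1 | (t <= k <= j)%N) Wmax k < 1)].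

Definition right_block (j : 'I_l.+1) : bool :=
  [forall t : 'I_l.+1, (j <= t)%N ==>
    (\prod_(k < l.+1 | (j <= k <= t)%N) Wmax k < 1)].

End BlockVertices.

(* Ulam-Harris labels: (i, w) is the vertex reached from the root v_i by
   following the word w of child indices, of length at most r; indices below n
   suffice since a Binom(n, d/n) variable is at most n almost surely. *)
Notation vertex l n r := ('I_l.+1 * {bseq r of 'I_n})%type.

Section RandomTree.
Variables (l n r : nat).
Local Notation V := (vertex l n r).

Definition spine (i : 'I_l.+1) : V := (i, [bseq]).

Variable N : V -> nat.  (* offspring numbers *)

Definition in_tree (u : V) : bool :=
  [forall a : V, forall k : 'I_n,
    (a.1 == u.1) && prefix (rcons a.2 k) u.2 ==> (k < N a)%N].

Definition parent (u w : V) : bool :=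
  (u.1 == w.1) && [exists k : 'I_n, w.2 == rcons u.2 k :> seq 'I_n].

Definition next_spine (u w : V) : bool :=
  [exists i : 'I_l.+1, exists j : 'I_l.+1,
    [&& j == i.+1 :> nat, u == spine i & w == spine j]].

Definition tree_adj (u w : V) : bool :=
  [&& in_tree u, in_tree w &
      [|| parent u w, parent w u, next_spine u w | next_spine w u]].

End RandomTree.

Section RandomTreeLaw.
Context {R : realType} {disp : measure_display} {Om : measurableType disp}.
Variable P : probability Om R.

Definition events_of (d' : measure_display) (S : measurableType d')
    (X : Om -> S) : set (set Om) :=
  [set X @^-1` B | B in measurable].

Definition mutually_independent (I : finType) (F : I -> set (set Om)) : Prop :=
  forall E : I -> set Om, (forall i, F i (E i)) ->
  forall K : {set I},
    P (\bigcap_(i in [set` K]) E i) = (\prod_(i in K) P (E i))%E.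

(* Only the offspring numbers of vertices of depth < r that are in the tree and
   the couplings of edges of the tree matter; the other variables are there so
   that the index sets are not random. *)
Definition random_tree_construction (l n r : nat) (d : R)
    (N : vertex l n r -> {RV P >-> nat})
    (J : {set vertex l n r} -> {RV P >-> R}) : Prop :=
  [/\ forall u (B : set nat), measurable B ->
        distribution P (N u) B = binomial_prob n (d / n%:R) B,
      forall e (B : set R), measurable B ->
        distribution P (J e) B = normal_prob 0 1 B &
      mutually_independent (fun x : vertex l n r + {set vertex l n r} =>
        match x with
        | inl u => events_of (N u)
        | inr e => events_of (J e)
        end)].

Section Events.
Variables (l n r : nat) (d eps beta : R).
Variables (N : vertex l n r -> {RV P >-> nat}).
Variables (J : {set vertex l n r} -> {RV P >-> R}).

Let adj_at (w : Om) : rel (vertex l n r) := tree_adj (fun u => N u w).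
Let J_at (w : Om) (e : {set vertex l n r}) : R := J e w.

Definition few_left_blocks : set Om :=
  [set w | #|[pred j | left_block d eps beta (adj_at w) (J_at w) r
                         (@spine l n r) j]|%:R < 7 / 10 * l%:R :> R].

Definition few_right_blocks : set Om :=
  [set w | #|[pred j | right_block d eps beta (adj_at w) (J_at w) r
                         (@spine l n r) j]|%:R < 7 / 10 * l%:R :> R].

End Events.
End RandomTreeLaw.

(* Main.v *)
(** Put q0 = 1 - eps/4 and W_i = W_P(v_i). If many vertices of the spine fail to be
    left-block (or right-block) vertices, greedily covering them by intervals on
    which the product of the W_i is at least 1 shows that the product of the W_i/q0
    is at least q0^(-number of failures). By Markov's inequality it thus suffices to
    bound the s-th moment of that product, with s of order d^(3/4).

    A path leaving the spine at v_i is the chain of prefixes of a word of the tree,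
    so the s-th power of W_i/q0 is at most the sum over such words w of
    q0^(s|w|) times the product over the prefixes u of w of
    1 + K exp(lam A(u)), where lam = c0 d and K = (2 e d)^s exp(-lam (1 - eps/2)).
    Expanding all products and using independence, every edge contributes an
    exponential moment g_m = E exp(m lam Gamma), m <= 2; charging the edges to their
    ends bounds the expectation by a product over vertices of g_2^2 g_1^(offspring),
    and the sum over words becomes a geometric series with ratio at most
    q0^s E[N (1 + K g_2^2 g_1^N)], N binomial. Since Gamma <= beta |J| / 2,
    E|J| = sqrt (2/pi) and beta <= (1 - eps) sqrt (2 pi) / d, one gets
    g_1 <= 1 + c0 (1 - 3 eps/4), hence K E[g_1^N] tends to 0 and the moment is at
    most 3^(l+1). *)

Require Import Defs.
From HB Require Import structures.
From mathcomp Require Import all_boot all_order all_algebra.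
From mathcomp Require Import all_classical all_reals all_analysis.
From mathcomp Require Import measurable_realfun.
From mathcomp Require Import ring lra zify.

Set Implicit Arguments.
Unset Strict Implicit.
Unset Printing Implicit Defensive.

Import Order.TTheory GRing.Theory Num.Theory.
Import numFieldNormedType.Exports.

Local Open Scope classical_set_scope.
Local Open Scope ring_scope.

(** * Integration against a density and a push-forward *)

Section Density.
Local Open Scope ereal_scope.
Context (d1 d2 : measure_display) (S : measurableType d1) (T : measurableType d2)
  (R : realType).
Variables (mu : {measure set S -> \bar R}) (nu : {measure set T -> \bar R}).
Variables (g : S -> R) (X : S -> T).
Hypotheses (mg : measurable_fun setT g) (mX : measurable_fun setT X).
Hypothesis (g0 : forall x, (0 <= g x)%R).
Hypothesis gX : forall B, measurable B ->
  \int[mu]_(x in X @^-1` B) (g x)%:E = nu B.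

Import HBNNSimple.

(** The hypothesis [gX] says that [nu] is the push-forward by [X] of the measure with density [g];
    simple functions and monotone convergence extend it to [f]. It serves for the Gaussian density
    ([X] the identity), for laws of variables ([g] equal to 1) and for the independence
    induction. *)
Lemma ge0_integral_density (f : T -> R) : measurable_fun setT f ->
    (forall y, 0 <= f y)%R ->
  \int[mu]_x (g x * f (X x))%:E = \int[nu]_y (f y)%:E.
Proof.
move=> mf f0.
have mEf : measurable_fun setT (fun y => (f y)%:E) by exact/measurable_EFinP.
pose h := nnsfun_approx measurableT mEf.
have cvh y : (EFin \o h n) y @[n --> \oo] --> (f y)%:E.
  by apply: (cvg_nnsfun_approx measurableT mEf) => // z _; rewrite lee_fin.
have mhX n : measurable_fun setT (fun x => h n (X x)).
  exact: (measurableT_comp (measurable_funPT (h n)) mX).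
have -> : \int[nu]_y (f y)%:E = limn (fun n => \int[nu]_y (h n y)%:E).
  rewrite -monotone_convergence//=.
  - by apply: eq_integral => y _; apply/esym/cvg_lim => //; exact: cvh.
  - by move=> n; exact/measurable_EFinP.
  - by move=> n x _; rewrite lee_fin.
  - by move=> x _ a b ab; rewrite lee_fin//; exact/lefP/nd_nnsfun_approx.
have -> : \int[mu]_x (g x * f (X x))%:E
    = limn (fun n => \int[mu]_x (g x * h n (X x))%:E).
  rewrite -monotone_convergence//=.
  - apply: eq_integral => x _; apply/esym/cvg_lim => //.
    rewrite EFinM; under eq_fun do rewrite EFinM.
    by apply: cvgeZl => //; exact: cvh.
  - by move=> n; apply/measurable_EFinP/measurable_funM.
  - by move=> n x _; rewrite lee_fin mulr_ge0.
  - by move=> x _ a b ab; rewrite lee_fin ler_wpM2l//; exact/lefP/nd_nnsfun_approx.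
congr (limn _); apply/funext => n.
transitivity (\int[nu]_y
   (\sum_(z \in range (h n)) (z * \1_(h n @^-1` [set z]) y)%:E)); last first.
  by apply: eq_integral => y _; rewrite /= fimfunE -fsumEFin.
have indich r : measurable_fun setT (fun y => (r * \1_(h n @^-1` [set r]) y)%:E).
  by apply/measurable_EFinP/measurable_funM.
rewrite ge0_integral_fsum//; last by move=> m y _; exact: nnfun_muleindic_ge0.
transitivity (\int[mu]_x (\sum_(z \in range (h n))
    (z * \1_(h n @^-1` [set z]) (X x))%:E * (g x)%:E)).
  apply: eq_integral => x _.
  rewrite -ge0_mule_fsuml => [|y]; last exact: nnfun_muleindic_ge0.
  by rewrite fsumEFin // -(fimfunE _ (X x)) muleC EFinM.
rewrite ge0_integral_fsum//; last 2 first.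
  - move=> y; apply: emeasurable_funM; last exact/measurable_EFinP.
    apply: (measurableT_comp (indich y) mX).
  - by move=> m y _; rewrite mule_ge0 ?lee_fin// -lee_fin nnfun_muleindic_ge0.
(* For a single level set of [h n], the claim is [gX] applied to that set. *)
apply: eq_fsbigr => r rhn.
under [RHS]eq_integral do rewrite EFinM.
rewrite integralZl_indic_nnsfun => //.
under eq_integral do rewrite EFinM -muleA.
have mI : measurable (X @^-1` (h n @^-1` [set r])).
  by rewrite -[X in measurable X]setTI; apply: mX => //; exact: measurable_funPTI.
have iE x : \1_(h n @^-1` [set r]) (X x) = \1_(X @^-1` (h n @^-1` [set r])) x :> R.
  by rewrite !indicE; congr (_%:R); congr nat_of_bool; apply/idP/idP; rewrite !inE.
rewrite ge0_integralZl//.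
- under eq_integral do rewrite muleC iE.
  rewrite (eq_integral ((EFin \o g) \_ (X @^-1` (h n @^-1` [set r])))); last first.
    by move=> x xE; rewrite epatch_indic.
  by rewrite -integral_mkcond gX// integral_indic// setIT.
- under eq_fun do rewrite iE.
  by apply: emeasurable_funM; apply/measurable_EFinP.
- by move=> t _; rewrite mule_ge0 ?lee_fin.
- by move: rhn; rewrite inE => -[t _ <-]; rewrite lee_fin.
Qed.

End Density.

(** * Expectation of a product of independent nonnegative variables *)

Section IndependentProduct.
Local Open Scope ereal_scope.
Context (R : realType) (disp : measure_display) (Om : measurableType disp).
Variables (P : probability Om R) (I : finType) (F : I -> set (set Om)).
Hypothesis FP : mutually_independent P F.
Hypothesis Fmeas : forall i A, F i A -> measurable A.
Variables (Y : I -> Om -> R) (e : I -> R).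
Hypothesis mY : forall i, measurable_fun setT (Y i).
Hypothesis Y0 : forall i x, (0 <= Y i x)%R.
Hypothesis FY : forall i B, measurable B -> F i (Y i @^-1` B).
Hypothesis eY : forall i, \int[P]_x (Y i x)%:E = (e i)%:E.

(** Indices still represented by events; those in [s] have been turned into functions. *)
Let outside (s : seq I) : {set I} := [set i | i \notin s]%SET.

Let bigcap_meas (E : I -> set Om) (K : {set I}) : (forall i, F i (E i)) ->
  measurable (\bigcap_(i in [set` K]) E i).
Proof.
move=> FE; apply: fin_bigcap_measurable => // i _.
exact: Fmeas (FE i).
Qed.

Let prod_ge0 (s : seq I) x : (0 <= \prod_(i <- s) Y i x)%R.
Proof. by apply: prodr_ge0 => i _; exact: Y0. Qed.

Let prod_meas (s : seq I) : measurable_fun setT (fun x => \prod_(i <- s) Y i x)%R.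
Proof.
elim: s => [|i s IH]; first by under eq_fun do rewrite big_nil; exact: measurable_cst.
by under eq_fun do rewrite big_cons; exact: measurable_funM.
Qed.

(* Turning the events into functions one index at a time lets each step be a
   change of measure with a constant density. *)
Let integral_prod_bigcap (s : seq I) : uniq s ->
  forall E : I -> set Om, (forall i, F i (E i)) ->
  \int[P]_(x in \bigcap_(i in [set` outside s]) E i) (\prod_(i <- s) Y i x)%:E =
  ((\prod_(i <- s) e i) * \prod_(i in outside s) fine (P (E i)))%:E.
Proof.
elim: s => [_|i s IH /= /andP[is_ us]] E FE.
  under eq_integral do rewrite big_nil.
  rewrite integral_cst ?mul1e; last exact: bigcap_meas.
  rewrite big_nil mul1r (big_morph EFin EFinM (erefl _)).
  apply: etrans (FP FE _) _.
  apply: eq_bigr => i _; rewrite fineK// fin_num_measure//.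
  exact: Fmeas (FE i).
have e0 j : (0 <= e j)%R.
  by rewrite -lee_fin -eY; apply: integral_ge0 => x _; rewrite lee_fin.
have [c cE] : exists c : R,
  c = ((\prod_(j <- s) e j) * \prod_(j in outside (i :: s)) fine (P (E j)))%R.
  by eexists.
have c0 : (0 <= c)%R; rewrite ?cE.
  by rewrite mulr_ge0// prodr_ge0// => j _; exact: fine_ge0.
set D := \bigcap_(_ in _) _.
have mD : measurable D by exact: bigcap_meas.
pose mYi := isMeasurableFun.Build _ _ _ _ _ (mY i).
pose Yi : {mfun Om >-> R} := HB.pack (Y i) mYi.
(* The induction hypothesis, with the event that [Y i] lies in [B] at index [i], shows that the
   density below is pushed forward by [Y i] to [c] times the law of [Y i]. *)
pose nu : {measure set R -> \bar R} := mscale (NngNum c0) (distribution P Yi).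
have H : forall B, measurable B ->
    \int[P]_(x in Y i @^-1` B) (\1_D x * \prod_(j <- s) Y j x)%:E = nu B.
  move=> B mB; pose E' j := if j == i then Y i @^-1` B else E j.
  have FE' j : F j (E' j).
    rewrite /E'; case: eqP => [->|_]; [exact: FY|exact: FE].
  rewrite (_ : nu B = c%:E * P (Y i @^-1` B))//.
  transitivity (\int[P]_(x in \bigcap_(j in [set` outside s]) E' j)
     (\prod_(j <- s) Y j x)%:E).
    rewrite [RHS]integral_mkcond [LHS]integral_mkcond.
    apply: eq_integral => x _; rewrite !patchE indicE.
    have -> : (x \in \bigcap_(j in [set` outside s]) E' j) =
      (x \in Y i @^-1` B) && (x \in D).
      apply/idP/andP; rewrite !inE.
        move=> h; split.
          by have := h i; rewrite /E' /= eqxx; apply; rewrite inE.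
        move=> j /=; rewrite inE in_cons negb_or => /andP[ji js].
        by have := h j; rewrite /E' /= (negPf ji); apply; rewrite inE.
      move=> [hB hD] j /=; rewrite inE /E'; case: eqP => [-> //|/eqP ji js].
      by apply: hD => /=; rewrite inE in_cons negb_or ji.
    by do 2 case: (x \in _) => //=; rewrite ?mul1r ?mul0r.
  rewrite IH//.
  have mYB : measurable (Y i @^-1` B) by apply: (@Fmeas i); exact: FY.
  have iO : i \in outside s by rewrite inE.
  rewrite (bigD1 i) //= {1}/E' eqxx.
  have -> : (\prod_(j in outside s | j != i) fine (P (E' j)) =
            \prod_(j in outside (i :: s)) fine (P (E j)))%R.
    apply: eq_big => [j|j /andP[_ /negPf ji]]; last by rewrite /E' ji.
    by rewrite !inE negb_or andbC.
  rewrite -[X in _ = _ * X]fineK ?fin_num_measure// -EFinM.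
  by rewrite cE; congr EFin; rewrite mulrCA mulrC.
have mg : measurable_fun setT (fun x => (\1_D x * \prod_(j <- s) Y j x)%R).
  by apply: measurable_funM => //; exact: measurable_indic.
(* The absolute value is used because the test function must be nonnegative on all of [R]; at the
   values of [Y i] it is the identity. *)
have := ge0_integral_density mg (mY i) (fun x => mulr_ge0 _ (prod_ge0 s x)) H
  (f := fun y => `|y|%R) (@normr_measurable _ _) (fun y => normr_ge0 y).
rewrite -/D => dens; rewrite integral_mkcond.
transitivity (\int[P]_x (\1_D x * \prod_(j <- s) Y j x * `|Y i x|)%:E).
  apply: eq_integral => x _; rewrite patchE indicE big_cons ger0_norm//.
  by case: (x \in D); rewrite ?mul1r ?mul0r // mulrC.
rewrite dens; last by move=> x; rewrite indicE.
rewrite ge0_integral_mscale //; last exact/measurable_EFinP.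
rewrite ge0_integral_pushforward//; last exact/measurable_EFinP.
rewrite preimage_setT (eq_integral (fun x => (Y i x)%:E)); last first.
  by move=> x _ /=; rewrite ger0_norm.
by rewrite eY -EFinM big_cons /= cE; congr EFin; rewrite mulrC mulrA.
Qed.

Lemma integral_prod_independent :
  \int[P]_x (\prod_i Y i x)%:E = (\prod_i e i)%:E.
Proof.
have FT i : F i setT by rewrite -(preimage_setT (Y i)); exact: FY.
have := integral_prod_bigcap (index_enum_uniq I) (fun i => FT i).
rewrite (_ : \bigcap_(_ in _) _ = setT); last first.
  by apply/seteqP; split.
move=> ->; rewrite [X in (_ * X)%R]big1 ?mulr1 // => i; rewrite inE mem_index_enum //.
Qed.

End IndependentProduct.

(** * Gaussian estimates for the couplings *)

Section AbsoluteGaussian.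
Context {R : realType}.
Local Notation mu := (@lebesgue_measure R).

Lemma nondecreasing_of_derive (u du : R -> R) :
  (forall z : R, is_derive z (1:R) u (du z)) ->
  (forall z : R, 0 <= z -> 0 <= du z) -> forall z : R, 0 <= z -> u 0 <= u z.
Proof.
move=> hu du0 z z0; have [->//|zn0] := eqVneq z 0.
apply: (@ger0_derive1_le_cc _ u 0 z) => //.
- move=> w; rewrite in_itv /= => /andP[w0 _]; rewrite derive1E.
  by have [_ ->] := hu w; rewrite du0// ltW.
- apply: continuous_subspaceT => w; apply: differentiable_continuous.
  by apply/derivable1_diffP; have [] := hu w.
- by rewrite in_itv /= ?lexx ?z0.
- by rewrite in_itv /= ?lexx ?z0.
Qed.

(** This is tanh (y/2) <= y/2 with denominators cleared. The difference has derivative 1 - (1 - x)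
    exp x, which is nonnegative because 1 - x <= exp (- x). *)
Lemma two_expR_le (y : R) : 0 <= y -> 2 * (expR y - 1) <= y * (expR y + 1).
Proof.
move=> y0; pose h x : R := x * (expR x + 1) - 2 * (expR x - 1).
have dh x : is_derive x (1:R) h (x * expR x + 1 * (expR x + 1) - 2 * expR x).
  rewrite /h; apply: is_derive_eq; rewrite ?scaler0 ?addr0 ?subr0 /GRing.scale /=; ring.
have := nondecreasing_of_derive dh _ y0; rewrite /h expR0; suff H : forall z : R, 0 <= z ->
    0 <= z * expR z + 1 * (expR z + 1) - 2 * expR z by move=> /(_ H); lra.
move=> x x0; have := expR_ge1Dx (- x); rewrite expRN => e.
have := ler_wpM2r (expR_ge0 x) e; rewrite mulVf ?gt_eqF ?expR_gt0//; nra.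
Qed.

(** The left side is |tanh (y/2)|, which is even in y, so [two_expR_le] suffices. *)
Lemma abs_expR_ratio_le (y : R) : `|1 - expR y| / (1 + expR y) <= `|y| / 2.
Proof.
wlog y0 : y / 0 <= y => [hw|].
  have [y0|y0] := leP 0 y; first exact: hw.
  have ep := expR_gt0 y.
  have := hw (- y); rewrite normrN oppr_ge0 => /(_ (ltW y0)); apply: le_trans.
  rewrite expRN -(@ler_pM2r _ (1 + expR y)) ?divfK ?addr_gt0 ?gt_eqF ?addr_gt0//.
  have -> : 1 - (expR y)^-1 = - ((1 - expR y) / expR y).
    by field; rewrite gt_eqF.
  rewrite normrN normrM normfV (gtr0_norm ep).
  rewrite le_eqVlt; apply/orP; left; apply/eqP; field.
  by rewrite gt_eqF//= addrC gt_eqF// addr_gt0.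
rewrite (ger0_norm y0) ler_pdivrMr ?addr_gt0 ?expR_gt0//.
have e1 : 1 <= expR y by rewrite -[leLHS]expR0 ler_expR.
rewrite ler0_norm ?subr_le0//; have := two_expR_le y0; lra.
Qed.

(** The linear term stays exact, since its Gaussian mean determines the threshold for beta. The
    quadratic remainder may be crude as long as it is integrable, and exp (x^2/4) is integrable
    against exp (- x^2/2). *)
Lemma expR_abs_le (t x : R) : 0 <= t <= 1 ->
  expR (t * `|x|) <= 1 + t * `|x| + 4 * expR 2 * t ^+ 2 * expR (x ^+ 2 / 4).
Proof.
move=> /andP[t0 t1].
(* Taylor bound of order two: [h] and [k] vanish at 0, [h] has derivative [k] plus a nonnegative
   term, and [k] has derivative z exp z. *)
have q (y : R) : 0 <= y -> expR y <= 1 + y + y ^+ 2 * expR y / 2.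
  move=> y0; pose h z : R := z + z ^+ 2 * expR z / 2 - (expR z - 1).
  pose k z : R := 1 - expR z + z * expR z.
  have dk x' : is_derive x' (1:R) k (x' * expR x').
    rewrite /k; apply: is_derive_eq; rewrite ?scaler0 ?addr0 ?subr0 /GRing.scale /=; ring.
  have dh x' : is_derive x' (1:R) h (k x' + x' ^+ 2 * expR x' / 2).
    rewrite /h /k; apply: is_derive_eq; rewrite ?scaler0 ?addr0 ?subr0 /GRing.scale /=; by field.
  have k0 z : 0 <= z -> 0 <= k z.
    move=> z0; have := nondecreasing_of_derive dk (fun w w0 => mulr_ge0 w0 (expR_ge0 w)) z0.
    by rewrite /k expR0; lra.
  have := nondecreasing_of_derive dh _ y0; rewrite /h expR0 expr0n /=.
  move=> H; suff: 0 <= y + y ^+ 2 * expR y / 2 - (expR y - 1) by lra.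
  apply: le_trans (H _); first by lra.
  by move=> z z0; rewrite addr_ge0 ?k0// divr_ge0// mulr_ge0 ?sqr_ge0 ?expR_ge0.
apply: le_trans (q _ (mulr_ge0 t0 (normr_ge0 x))) _; rewrite lerD2l.
have ->: (t * `|x|) ^+ 2 = t ^+ 2 * x ^+ 2 by rewrite exprMn real_normK ?num_real.
have h1 : x ^+ 2 <= 8 * expR (x ^+ 2 / 8).
  by have := expR_ge1Dx (x ^+ 2 / 8); lra.
(* The inequality |x| <= 2 + x^2/8 is (|x| - 4)^2 >= 0. *)
have h2 : expR (t * `|x|) <= expR 2 * expR (x ^+ 2 / 8).
  rewrite -expRD ler_expR; apply: (@le_trans _ _ `|x|); first by rewrite ler_piMl.
  rewrite -(real_normK (num_real x)); have := sqr_ge0 (`|x| - 4); rewrite sqrrB; lra.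
have -> : expR (x ^+ 2 / 4) = expR (x ^+ 2 / 8) * expR (x ^+ 2 / 8) :> R.
  by rewrite -expRD; congr expR; lra.
have : x ^+ 2 * expR (t * `|x|) <= 8 * expR (x ^+ 2 / 8) * (expR 2 * expR (x ^+ 2 / 8)).
  by rewrite ler_pM ?sqr_ge0 ?expR_ge0.
move=> h; have := ler_wpM2l (sqr_ge0 t) h; lra.
Qed.

Lemma ge0_integral_normal_prob (f : R -> R) : measurable_fun setT f ->
  (forall x, 0 <= f x) ->
  (\int[normal_prob 0 1]_x (f x)%:E = \int[mu]_x (normal_pdf 0 1 x * f x)%:E)%E.
Proof.
move=> mf f0; symmetry.
apply: (@ge0_integral_density _ _ _ _ _ mu (normal_prob 0 1) (normal_pdf 0 1) id) => //.
- exact: measurable_normal_pdf.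
- by move=> x; exact: normal_pdf_ge0.
Qed.

Let peak1 : normal_peak (1 : R) = (Num.sqrt (2 * pi))^-1.
Proof. by rewrite /normal_peak expr1n mul1r mulr_natl. Qed.

Let fun1 (x : R) : normal_fun 0 1 x = expR (- x ^+ 2 / 2).
Proof. by rewrite /normal_fun subr0 expr1n. Qed.

(** By symmetry this is twice the integral over the half-line, where - exp (- x^2/2) is a
    primitive. *)
Lemma gaussian_abs_moment :
  (\int[normal_prob 0 1]_x (`|x| : R)%:E = (2 * (Num.sqrt (2 * pi))^-1)%:E)%E.
Proof.
rewrite ge0_integral_normal_prob//.
have c1 : (1 : R) != 0 by rewrite oner_neq0.
rewrite normal_pdfE//.
under eq_integral do rewrite -mulrA EFinM.
have cf : continuous (fun x : R => normal_fun 0 1 x * `|x|).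
  move=> x; apply: cvgM; last exact: norm_continuous.
  have -> : normal_fun (0:R) 1 = (fun x => (normal_peak 1)^-1 * normal_pdf 0 1 x).
    by apply/funext => z; rewrite normal_pdfE// mulKf// gt_eqF// normal_peak_gt0.
  by apply: cvgM; [exact: cvg_cst|exact: continuous_normal_pdf].
have f0 (x : R) : 0 <= normal_fun 0 1 x * `|x| by rewrite mulr_ge0 ?normal_fun_ge0.
rewrite ge0_integralZl//=; last 3 first.
- apply/measurable_EFinP; apply: measurable_funM; last exact: normr_measurable.
  exact: measurable_normal_fun.
- by move=> x _; rewrite lee_fin.
- by rewrite lee_fin normal_peak_ge0.
rewrite ge0_symfun_integralT//=; last first.
  by move=> x /=; rewrite normrN /normal_fun !subr0 sqrrN.
rewrite (_ : [set x | _] = `[0, +oo[%classic); last first.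
  by apply/seteqP; split => x/=; rewrite in_itv/= andbT.
pose F (x : R) := - expR (- x ^+ 2 / 2).
have dF (x : R) : is_derive x (1:R) F (x * expR (- x ^+ 2 / 2)).
  rewrite /F; apply: is_derive_eq; rewrite ?scaler0 ?addr0 ?subr0 /GRing.scale /=; by field.
rewrite (@ge0_continuous_FTC2y _ _ F 0 0)//.
- rewrite -EFinB -!EFinM peak1 /F expr0n /= oppr0 mul0r expR0 sub0r opprK.
  by rewrite mulr1 mulrC.
- by apply: continuous_subspaceT => x; exact: cf.
- rewrite /F -[X in _ --> X]oppr0; apply: cvgN.
  under eq_fun do rewrite mulNr.
  apply: (cvg_comp (fun x : R => x ^+ 2 / 2) (fun x => expR (- x)) _ (@cvgr_expR R)).
  by apply/gt0_cvgMly; [rewrite invr_gt0|exact: cvgr_expr2].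
- apply: cvg_at_right_filter; apply: differentiable_continuous.
  by apply/derivable1_diffP; have [] := dF 0.
- move=> x; rewrite in_itv /= andbT => x0; rewrite derive1E; have [_ ->] := dF x; rewrite fun1.
  by rewrite gtr0_norm// mulrC.
Qed.

(** Multiplying the standard density by exp (x^2/4) gives sqrt 2 times the Gaussian density of
    variance 2. *)
Lemma gaussian_expR_sqr_moment :
  (\int[normal_prob 0 1]_x (expR (x ^+ 2 / 4) : R)%:E = (Num.sqrt 2)%:E)%E.
Proof.
have me : measurable_fun setT (fun x : R => expR (x ^+ 2 / 4)).
  by apply: measurableT_comp => //; apply: measurable_funM => //; exact: measurable_funX.
rewrite ge0_integral_normal_prob//.
have s20 : Num.sqrt 2 != 0 :> R by rewrite gt_eqF// sqrtr_gt0.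
transitivity (\int[mu]_x ((Num.sqrt 2)%:E * (normal_pdf 0 (Num.sqrt 2) x)%:E))%E.
  apply: eq_integral => x _; rewrite -EFinM !normal_pdfE ?oner_neq0// fun1 peak1 -mulrA -expRD.
  congr EFin; rewrite mulrA; congr (_ * _).
    rewrite /normal_peak sqr_sqrtr//.
    have -> : 2 * pi *+ 2 = 2 * (2 * pi) :> R by lra.
    rewrite (sqrtrM (2 * pi) (_ : 0 <= 2)) // invfM mulrA divff// mul1r //.
  rewrite /normal_fun subr0 sqr_sqrtr//; congr expR; by field.
rewrite ge0_integralZl//=.
- by rewrite integral_normal_pdf mule1.
- by apply/measurable_EFinP; exact: measurable_normal_pdf.
- by move=> x _; rewrite lee_fin normal_pdf_ge0.
Qed.

Lemma gaussian_expR_abs_le (t : R) : 0 <= t <= 1 ->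
  (\int[normal_prob 0 1]_x (expR (t * `|x|))%:E <=
   (1 + t * (2 * (Num.sqrt (2 * pi))^-1) + 4 * expR 2 * t ^+ 2 * Num.sqrt 2)%:E)%E.
Proof.
move=> t01; have /andP[t0 t1] := t01.
have c0 : 0 <= 4 * expR 2 * t ^+ 2 :> R by rewrite !mulr_ge0 ?expR_ge0// sqr_ge0.
have mn : measurable_fun setT (fun x : R => t * `|x|).
  by apply: measurable_funM => //; exact: normr_measurable.
have me : measurable_fun setT (fun x : R => expR (x ^+ 2 / 4)).
  by apply: measurableT_comp => //; apply: measurable_funM => //; exact: measurable_funX.
apply: (@le_trans _ _ (\int[normal_prob 0 1]_x (1 + t * `|x| + 4 * expR 2 * t ^+ 2 * expR (x ^+ 2 / 4))%:E)%E).
  apply: ge0_le_integral => //.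
  - by apply/measurable_EFinP; apply: measurableT_comp.
  - apply/measurable_EFinP; apply: measurable_funD; first exact: measurable_funD.
    exact: measurable_funM.
  - by move=> x _; rewrite lee_fin; exact: expR_abs_le.
under eq_integral do rewrite !EFinD EFinM EFinM.
rewrite ge0_integralD//=; last 4 first.
- by move=> x _; rewrite lee_fin addr_ge0// mulr_ge0.
- by apply/measurable_EFinP; exact: measurable_funD.
- by move=> x _; rewrite lee_fin mulr_ge0 ?expR_ge0.
- by apply/measurable_EFinP; exact: measurable_funM.
rewrite ge0_integralD//=; last 2 first.
- by move=> x _; rewrite lee_fin mulr_ge0.
- by apply/measurable_EFinP.
rewrite integral_cst// ge0_integralZl//=; last first.
  by apply/measurable_EFinP; exact: normr_measurable.
rewrite ge0_integralZl//=; last exact/measurable_EFinP.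
by rewrite gaussian_abs_moment gaussian_expR_sqr_moment probability_setT mule1 -!EFinM -!EFinD.
Qed.

End AbsoluteGaussian.

(** * Covering the failing vertices by intervals *)

Section BlockCounting.
Variables (R : realType) (q : R).
Hypothesis q01 : 0 < q <= 1.

Let q_gt0 : 0 < q. Proof. by case/andP: q01. Qed.
Let q_ge0 : 0 <= q. Proof. exact: ltW. Qed.
Let q_le1 : q <= 1. Proof. by case/andP: q01. Qed.

Section Nat.
Variables (m : nat) (x : nat -> R).
Hypothesis qx : forall k, (k < m)%N -> q <= x k.

Let prod_div_ge1 a b : (b <= m)%N -> 1 <= \prod_(a <= k < b) (x k / q).
Proof.
move=> bm; rewrite big_nat; apply: (big_ind (fun z => 1 <= z)) => //.
  by move=> y z; exact: mulr_ege1.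
by move=> k /andP[_ kb]; rewrite ler_pdivlMr// mul1r qx// (leq_trans kb).
Qed.

Let prod_div a b : \prod_(a <= k < b) (x k / q) =
  \prod_(a <= k < b) x k * q ^- (b - a).
Proof. by rewrite big_split /= prodr_const_nat exprVn. Qed.

(** Adjoining an interval of [b] indices with product [Q] at least 1: its normalised product
    [Q * q ^- b] pays for up to [b] further heavy indices, whichever they are. *)
Let step (a b c : nat) (P : R) : (c <= a + b)%N -> 0 <= P -> 1 <= P * q ^+ a ->
  forall Q : R, 1 <= Q -> 1 <= (Q * q ^- b) * P * q ^+ c.
Proof.
move=> cab P0 h Q Q1.
have : P * q ^+ a * 1 <= P * q ^+ a * Q by rewrite ler_wpM2l// mulr_ge0 ?exprn_ge0.
have e : q ^+ (a + b) <= q ^+ c by rewrite ler_wiXn2l.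
rewrite mulr1 => h'; apply: le_trans h _; apply: le_trans h' _.
have -> : P * q ^+ a * Q = Q * q ^- b * P * q ^+ (a + b).
  by rewrite exprD; field; rewrite gt_eqF// exprn_gt0.
rewrite ler_wpM2l// !mulr_ge0 ?invr_ge0 ?exprn_ge0 ?(le_trans ler01 Q1)//.
Qed.

(** Failure of the left-block condition, over natural numbers so that intervals can be cut and
    joined. *)
Definition left_heavy j := [exists t : 'I_j.+1, 1 <= \prod_(t <= k < j.+1) x k].

(** Strong induction from the right end. If the last index is heavy with witness [t], the interval
    starting at [t] is cut off and pays for all heavy indices inside it. Otherwise the last factor,
    which is at least 1, is dropped. *)
Lemma left_heavy_count b : (b <= m)%N ->
  1 <= \prod_(0 <= k < b) (x k / q) * q ^+ count left_heavy (iota 0 b).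
Proof.
elim/ltn_ind: b => -[|b] IH bm; first by rewrite big_geq// mul1r expr0.
have [/existsP[/= t ht]|nh] := boolP (left_heavy b).
  have tb : (t <= b)%N by rewrite -ltnS.
  rewrite (big_cat_nat (n := t))//=; last exact: leq_trans tb _.
  rewrite (prod_div t) [X in X * q ^+ _]mulrC.
  apply: (step (a := count left_heavy (iota 0 t)) (b := b.+1 - t)) => //.
  - rewrite -[leqLHS]/(count left_heavy (iota 0 b.+1)).
    have -> : count left_heavy (iota 0 b.+1) =
        (count left_heavy (iota 0 t) + count left_heavy (iota t (b.+1 - t)))%N.
      by rewrite -count_cat -[X in iota X (b.+1 - t)](add0n t) -iotaD subnKC// ltnW.
    rewrite leq_add2l.
    by apply: leq_trans (count_size _ _) _; rewrite size_iota.
  - rewrite (le_trans ler01)// prod_div_ge1//.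
    exact: leq_trans (leq_trans tb (leqnSn b)) bm.
  - apply: IH; first exact: ltn_ord.
    exact: leq_trans (leq_trans tb (leqnSn b)) bm.
have -> : count left_heavy (iota 0 b.+1) = count left_heavy (iota 0 b).
  by rewrite -addn1 iotaD count_cat /= add0n (negPf nh) !addn0.
rewrite big_nat_recr//=.
apply: le_trans (IH b (ltnSn b) (ltnW bm)) _.
rewrite -mulrA [leRHS]mulrCA ler_peMl ?mulr_ge0 ?exprn_ge0//.
  by rewrite (le_trans ler01)// prod_div_ge1// ltnW.
by rewrite ler_pdivlMr// mul1r qx.
Qed.

Definition right_heavy j :=
  [exists t : 'I_m, (j <= t)%N && (1 <= \prod_(j <= k < t.+1) x k)].

(** Mirror image of [left_heavy_count]: the induction runs over suffixes, and intervals are cut off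
    at their left end. *)
Lemma right_heavy_count n a : (a + n = m)%N ->
  1 <= \prod_(a <= k < m) (x k / q) * q ^+ count right_heavy (iota a n).
Proof.
elim/ltn_ind: n a => -[|n] IH a am.
  by rewrite big_geq ?mul1r ?expr0// -am addn0.
have am' : (a < m)%N by rewrite -am -addn1 leq_add2l.
have [/existsP[/= t /andP[at_ ht]]|nh] := boolP (right_heavy a).
  have tm : (t < m)%N := ltn_ord t.
  rewrite (big_cat_nat (n := t.+1))//=; last exact: leqW.
  rewrite (prod_div a).
  apply: (step (a := count right_heavy (iota t.+1 (m - t.+1))) (b := t.+1 - a)) => //.
  - rewrite -[leqLHS]/(count right_heavy (iota a n.+1)).
    have -> : n.+1 = (t.+1 - a + (m - t.+1))%N by lia.
    rewrite iotaD count_cat subnKC ?leqW// addnC leq_add2l.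
    by apply: leq_trans (count_size _ _) _; rewrite size_iota.
  - by rewrite (le_trans ler01)// prod_div_ge1.
  - by apply: IH; lia.
rewrite big_ltn//= (negPf nh) add0n -mulrA.
have h : 1 <= \prod_(a.+1 <= k < m) (x k / q) * q ^+ count right_heavy (iota a.+1 n).
  by apply: IH => //; rewrite addSnnS.
apply: le_trans h _; rewrite ler_peMl ?mulr_ge0 ?exprn_ge0//.
  by rewrite (le_trans ler01)// prod_div_ge1.
by rewrite ler_pdivlMr// mul1r qx.
Qed.

End Nat.

Variables (l : nat) (W : 'I_l.+1 -> R).
Hypothesis qW : forall k, q <= W k.

Let x k := W (inord k).
Let qx k : (k < l.+1)%N -> q <= x k. Proof. by move=> _; exact: qW. Qed.

Let count_ord (A : pred nat) : count A (iota 0 l.+1) = #|[pred j : 'I_l.+1 | A j]|.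
Proof.
by rewrite -sum1_card -sum1_count -[iota 0 l.+1]/(index_iota 0 l.+1) big_mkord.
Qed.

Let prod_ord (P : pred nat) (F : R -> R) :
  \prod_(k < l.+1 | P k) F (W k) = \prod_(0 <= k < l.+1 | P k) F (x k).
Proof. by rewrite big_mkord; apply: eq_bigr => k _; rewrite /x inord_val. Qed.

Let prod_itv (t j : nat) : (j < l.+1)%N ->
  \prod_(k < l.+1 | (t <= k <= j)%N) W k = \prod_(t <= k < j.+1) x k.
Proof.
move=> jl; rewrite (prod_ord (fun k => t <= k <= j)%N id).
rewrite [RHS](big_nat_widenl t 0)// [RHS](big_nat_widen _ _ l.+1)//.
Qed.

Lemma prod_ge_left_nonblocks :
  1 <= \prod_k (W k / q) * q ^+ #|[pred j : 'I_l.+1 | ~~ [forall t : 'I_l.+1,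
    (t <= j)%N ==> (\prod_(k < l.+1 | (t <= k <= j)%N) W k < 1)]]|.
Proof.
have := left_heavy_count qx (leqnn l.+1); rewrite -(prod_ord xpredT (fun y => y / q)).
rewrite count_ord; congr (_ <= _ * q ^+ _); apply: eq_card => j; rewrite !inE.
rewrite negb_forall; apply/existsP/existsP => -[t].
  move=> h; have tl : (t < l.+1)%N by rewrite (leq_trans (ltn_ord t)).
  exists (Ordinal tl); rewrite /= negb_imply -ltnS ltn_ord /= -leNgt prod_itv//.
rewrite negb_imply -leNgt -ltnS => /andP[tj]; rewrite prod_itv// => h.
by exists (Ordinal tj).
Qed.

Lemma prod_ge_right_nonblocks :
  1 <= \prod_k (W k / q) * q ^+ #|[pred j : 'I_l.+1 | ~~ [forall t : 'I_l.+1,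
    (j <= t)%N ==> (\prod_(k < l.+1 | (j <= k <= t)%N) W k < 1)]]|.
Proof.
have := right_heavy_count qx (add0n l.+1); rewrite -(prod_ord xpredT (fun y => y / q)).
rewrite count_ord; congr (_ <= _ * q ^+ _); apply: eq_card => j; rewrite !inE.
rewrite negb_forall; apply: eq_existsb => t.
by rewrite negb_imply -leNgt prod_itv.
Qed.

End BlockCounting.

(** * Paths leaving the spine are words of the tree *)

Section TreePaths.
Variables (l n r : nat).
Local Notation V := (vertex l n r).
Local Notation word := ({bseq r of 'I_n}).

Definition word_take (w : word) (j : nat) : word := take_bseq j w.

Lemma big_prefix (R : comPzSemiRingType) (w : word) (F : word -> R) :
  \prod_(b : word | prefix b w) F b = \prod_(j < (size w).+1) F (word_take w j).
Proof.
rewrite (reindex_onto (fun j : 'I_(size w).+1 => word_take w j)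
  (fun b => inord (size b))); last first.
  move=> b bw; apply: val_inj; rewrite /= inordK ?ltnS ?size_prefix//.
  by apply/eqP; rewrite -prefixE.
apply: eq_bigl => j; rewrite prefix_take /=; apply/eqP/val_inj.
by rewrite /= size_take_min (minn_idPl _) ?inord_val// -ltnS.
Qed.

Lemma parent_size (u w : V) : parent u w -> size w.2 = (size u.2).+1.
Proof. by case/andP => _ /existsP[k /eqP ->]; rewrite size_rcons. Qed.

Lemma parent_word_take (u w : V) : parent u w -> u = (w.1, word_take w.2 (size w.2).-1).
Proof.
move=> h; have sz := parent_size h; case/andP: h => /eqP e /existsP[k /eqP ek].
case: u w e ek sz => [i b] [j c] /= <- ek sz; congr (_, _); apply: val_inj => /=.
by rewrite sz /= ek -cats1 take_size_cat.
Qed.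

Lemma next_spine_codom (u w : V) : next_spine u w ->
  (u \in codom (@spine l n r)) /\ (w \in codom (@spine l n r)).
Proof.
by case/existsP => i /existsP[j /and3P[_ /eqP-> /eqP->]]; rewrite !codom_f.
Qed.

Lemma codom_spine (u : V) : u \in codom (@spine l n r) -> u.2 = [::] :> seq _.
Proof. by case/codomP => i ->. Qed.

Variable N : V -> nat.

(** Such a path can only descend: a step to the parent revisits the path, and a spine step ends on
    the spine. Its vertices are therefore the successive prefixes of its last word. *)
Lemma offpath_word (i : 'I_l.+1) (p : seq V) :
  offpath (tree_adj N) (@spine l n r) (spine n r i) p ->
  exists2 w : word, in_tree N (i, w) &
    spine n r i :: p = [seq (i, word_take w j) | j <- iota 0 (size w).+1].
Proof.
elim/last_ind: p => [_|p x IH].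
  exists [bseq] => /=.
    by apply/forallP => a; apply/forallP => k; rewrite prefixs0 -size_eq0 size_rcons andbF.
  by congr [:: (_, _)]; apply: val_inj.
rewrite /offpath rcons_path -rcons_cons rcons_uniq all_rcons.
move=> /and3P[/andP[pp adjx] /andP[xp up] /andP[xs ap]].
have [|w tw e] := IH; first by rewrite /offpath pp ap andbT.
have wE : word_take w (size w) = w by apply: val_inj; rewrite /= take_size.
have lastE : last (spine n r i) p = (i, w).
  rewrite -[LHS]/(last (spine n r i) (spine n r i :: p)) e -[X in iota 0 X]addn1 iotaD map_cat.
  by rewrite last_cat /= add0n wE.
move: adjx; rewrite lastE => /and3P[_ tx].
have /negPf xs' : x \notin codom (@spine l n r) := xs.
case/or4P.
- move=> px; have sz := parent_size px; case/andP: px => /= /eqP ix /existsP[k /eqP ek].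
  have xE : x = (i, x.2) by rewrite {1}ix; case: (x).
  exists x.2; first by rewrite -xE.
  change (rcons (spine n r i :: p) x =
    [seq (i, word_take x.2 j) | j <- iota 0 (size x.2).+1]).
  rewrite e sz -[(size (i, w).2).+2]addn1 iotaD map_cat.
  rewrite [X in _ = _ ++ X](_ : _ = [:: (i, word_take x.2 (size w).+1)])// cats1.
  congr rcons; last by rewrite {1}xE -sz; congr (_, _); apply: val_inj; rewrite /= take_size.
  apply/eq_in_map => j; rewrite mem_iota add0n => /andP[_ jw].
  congr (_, _); apply: val_inj; rewrite /= ek -cats1 takel_cat//.
- move=> px; have sz := parent_size px; have /= xE := parent_word_take px.
  case/negP: xp; rewrite e; apply/mapP; exists (size w).-1 => //.
  by rewrite mem_iota add0n ltnS leq_pred.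
- by move=> /next_spine_codom[_]; rewrite xs'.
- by move=> /next_spine_codom[]; rewrite xs'.
Qed.

End TreePaths.

(** * Sums of multiplicative weights over words *)

Lemma ler_sum_uniq_sub (R : realType) (T : eqType) (s s' : seq T) (F : T -> R) :
  (forall x, 0 <= F x) -> uniq s -> {subset s <= s'} ->
  \sum_(x <- s) F x <= \sum_(x <- s') F x.
Proof.
move=> F0; elim: s s' => [|x s IH] s' /=; first by rewrite big_nil sumr_ge0.
move=> /andP[xs us] ss'; have xs' : x \in s' by rewrite ss'// mem_head.
rewrite big_cons (perm_big _ (perm_to_rem xs')) big_cons lerD2l IH// => y ys.
have := ss' y; rewrite in_cons ys orbT => /(_ isT).
rewrite (perm_mem (perm_to_rem xs')) in_cons => /orP[/eqP yx|//].
by rewrite -yx ys in xs.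
Qed.

Section WordSums.
Variables (R : realType) (n : nat).

Fixpoint words (r : nat) : seq (seq 'I_n) :=
  if r is r'.+1 then [::] :: [seq k :: w | k <- enum 'I_n, w <- words r'] else [:: [::]].

Lemma mem_words r (w : seq 'I_n) : (size w <= r)%N -> w \in words r.
Proof.
elim: r w => [|r IH] [|k w] //= h.
by rewrite inE /=; apply/allpairsP; exists (k, w); rewrite mem_enum /= IH.
Qed.

(** Splitting off the first letter gives s_(r+1) = 1 + (sum of a) s_r for the sum s_r, and s_r <= 2
    is stable under this; the bound does not depend on r. *)
Lemma sum_words_le (a : 'I_n -> R) r : (forall k, 0 <= a k) ->
  \sum_k a k <= 1 / 2 -> \sum_(w <- words r) \prod_(k <- w) a k <= 2.
Proof.
move=> a0 a12; elim: r => [|r IH] /=.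
  by rewrite big_seq1 big_nil ler1n.
rewrite big_cons big_nil big_allpairs_dep /=.
rewrite big_enum /=.
under eq_bigr do under eq_bigr do rewrite big_cons.
under eq_bigr do rewrite -mulr_sumr.
rewrite -mulr_suml.
have s0 : 0 <= \sum_(w <- words r) \prod_(k <- w) a k.
  by apply: sumr_ge0 => w _; apply: prodr_ge0.
have s1 : 0 <= \sum_k a k by apply: sumr_ge0.
nra.
Qed.

Lemma sum_bseq_le (a : 'I_n -> R) r : (forall k, 0 <= a k) ->
  \sum_k a k <= 1 / 2 ->
  \sum_(w : {bseq r of 'I_n}) \prod_(k <- w) a k <= 2.
Proof.
move=> a0 a12; apply: le_trans (sum_words_le r a0 a12).
pose G (w : seq 'I_n) := \prod_(k <- w) a k.
have G0 w : 0 <= G w by apply: prodr_ge0.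
rewrite -(big_map (fun w : {bseq r of 'I_n} => w : seq _) xpredT G).
apply: ler_sum_uniq_sub => //.
- by rewrite map_inj_uniq ?index_enum_uniq//; exact: val_inj.
- by move=> w /mapP[b _ ->]; rewrite mem_words// size_bseq.
Qed.

End WordSums.

(** * Charging edges to their end vertices *)

Section EdgeCharging.
Variables (l n r : nat).
Local Notation V := (vertex l n r).
Variables (N : V -> nat) (S : {set V}).

(** The ends of [e] lying in [S], encoded as orientations of [e] whose first component is that end;
    an edge inside [S] has two. *)
Definition edge_ends (e : {set V}) : {set V * V} :=
  [set p : V * V | [&& p.1 \in S, tree_adj N p.1 p.2 & [set p.1; p.2]%SET == e]].

Definition edge_mult (e : {set V}) : nat := #|edge_ends e|.

Lemma tree_adj_neq (u w : V) : tree_adj N u w -> u != w.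
Proof.
case/and3P => _ _ h; apply/eqP => uw; rewrite -uw {w uw} in h.
have np : ~~ parent u u by apply/negP => /parent_size; lia.
have ns : ~~ next_spine u u.
  apply/negP => /existsP[i /existsP[j /and3P[/eqP ji /eqP-> /eqP[] ij]]].
  by move: ji; rewrite ij; lia.
by rewrite (negPf np) (negPf ns) in h.
Qed.

Lemma parent_asym (u w : V) : parent u w -> ~~ parent w u.
Proof.
move=> /parent_size h; apply/negP => /parent_size; lia.
Qed.

(** Membership of the child with label k in the tree forces k < N u, and labels are below n. *)
Lemma card_children (u : V) :
  (#|[pred w | tree_adj N u w && parent u w]| <= minn (N u) n)%N.
Proof.
pose A := [pred k : 'I_n | (k < N u)%N].
apply: (@leq_trans #|A|); last first.
  have An : (#|A| <= n)%N := leq_trans (max_card A) (eq_leq (card_ord n)).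
  rewrite leq_min An andbT cardE -(size_map val) -(size_iota 0 (N u)).
  apply: uniq_leq_size; first by rewrite map_inj_uniq ?enum_uniq//; exact: val_inj.
  by move=> x /mapP[k]; rewrite mem_enum inE => kN ->; rewrite mem_iota.
pose ch (k : 'I_n) : V := (u.1, insub_bseq r (rcons u.2 k)).
apply: leq_trans (leq_image_card ch A); apply/subset_leq_card/fintype.subsetP => w.
rewrite inE => /andP[/and3P[_ tw _] pw].
case/andP: pw => /eqP uw /existsP[k /eqP wk].
apply/fintype.imageP; exists k.
  have /forallP/(_ u)/forallP/(_ k) := tw.
  by rewrite uw eqxx wk prefix_refl.
by rewrite /ch -wk uw /insub_bseq valKd; case: (w).
Qed.

(** A spine vertex has no parent, so its other neighbours are on the spine; any other vertex has
    only its parent. At the ends of the spine a listed vertex need not be a neighbour, which is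
    harmless for an upper bound. *)
Lemma card_nonchildren (u : V) :
  (#|[pred w | tree_adj N u w && ~~ parent u w]| <= 2)%N.
Proof.
have two (a b : V) : (#|[set a; b]%SET| <= 2)%N by rewrite cards2; case: (a != b).
have [u0|u0] := eqVneq (u.2 : seq _) [::].
  apply: leq_trans (two (spine n r (inord u.1.+1)) (spine n r (inord u.1.-1))).
  apply/subset_leq_card/fintype.subsetP => w; rewrite !inE => /andP[/and3P[_ _ /or4P[]] h nh].
  - by rewrite h in nh.
  - by move/parent_size: h; rewrite u0.
  - case/existsP: h => i /existsP[j /and3P[/eqP ji /eqP-> /eqP->]] /=.
    by rewrite -ji inord_val eqxx.
  - case/existsP: h => i /existsP[j /and3P[/eqP ji /eqP-> /eqP->]] /=.
    by rewrite ji /= inord_val eqxx orbT.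
set v := (u.1, word_take u.2 (size u.2).-1).
apply: leq_trans (two v v); apply/subset_leq_card/fintype.subsetP => w.
have nsp : u \notin codom (@spine l n r) by apply: contra u0 => /codom_spine ->.
rewrite !inE => /andP[/and3P[_ _ /or4P[]] h nh].
- by rewrite h in nh.
- by rewrite (parent_word_take h) eqxx.
- by have [h1 _] := next_spine_codom h; rewrite h1 in nsp.
- by have [_ h1] := next_spine_codom h; rewrite h1 in nsp.
Qed.

Lemma edge_ends_sub (e : {set V}) p : p \in edge_ends e ->
  edge_ends e \subset [set p; (p.2, p.1)]%SET.
Proof.
case: p => a b; rewrite inE /= => /and3P[_ _ /eqP <-]; apply/fintype.subsetP => -[x y].
rewrite !inE /= => /and3P[_ _ /eqP h].
have xa : x \in [set a; b]%SET by rewrite -h !inE eqxx.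
have ya : y \in [set a; b]%SET by rewrite -h !inE eqxx orbT.
have ax : a \in [set x; y]%SET by rewrite h !inE eqxx.
have bx : b \in [set x; y]%SET by rewrite h !inE eqxx orbT.
move: xa ya ax bx; rewrite !inE !xpair_eqE.
by do 4 case/orP => /eqP ?; subst; rewrite ?eqxx ?orbT.
Qed.

Variables (R : realType) (g : nat -> R).
Hypotheses (g0 : g 0%N = 1) (g1 : 1 <= g 1%N) (g12 : g 1%N <= g 2%N).

(** Edges towards children get the lower rate because a vertex may have many of them, while at most
    two others start at it. *)
Let c (p : V * V) : R := if parent p.1 p.2 then g 1%N else g 2%N.

Let g2_ge1 : 1 <= g 2%N. Proof. exact: le_trans g12. Qed.
Let g1_ge0 : 0 <= g 1%N. Proof. exact: le_trans g1. Qed.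
Let g2_ge0 : 0 <= g 2%N. Proof. exact: le_trans g2_ge1. Qed.

(** If both ends of [e] lie in [S], its two orientations cannot both be downward, so one of them
    already pays [g 2] and the other pays at least 1. *)
Let edge_charge e : g (edge_mult e) <= \prod_(p in edge_ends e) c p.
Proof.
rewrite /edge_mult; have [->|] := set_0Vmem (edge_ends e).
  by rewrite cards0 g0 big_set0.
case=> -[a b] h; have sub := edge_ends_sub h.
have ab : a != b by move: h; rewrite inE => /and3P[_ /tree_adj_neq].
have neq : (a, b) \notin [set (b, a)]%SET by rewrite inE xpair_eqE (negPf ab).
have [h'|h'] := boolP ((b, a) \in edge_ends e).
  have -> : edge_ends e = [set (a, b); (b, a)]%SET.
    apply/eqP; rewrite finset.eqEsubset sub /=; apply/fintype.subsetP => p.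
    by rewrite !inE => /orP[] /eqP ->; [move: h|move: h']; rewrite inE.
  rewrite cards2 (_ : (a, b) != (b, a)) /=; last by move: neq; rewrite inE.
  rewrite big_setU1//= big_set1 /c /=.
  have [pab|_] := boolP (parent a b); first by rewrite (negPf (parent_asym pab)) ler_peMl.
  by case: (parent b a); rewrite ?ler_peMr// ler_peMr.
have -> : edge_ends e = [set (a, b)]%SET.
  apply/eqP; rewrite finset.eqEsubset finset.sub1set h andbT; apply/fintype.subsetP => p pe.
  have := fintype.subsetP sub _ pe; rewrite !inE => /orP[//|/eqP pE].
  by rewrite pE (negPf h') in pe.
by rewrite cards1 big_set1 /c; case: ifP.
Qed.

(* An edge seen from both of its ends is charged once at rate [g 1] and once at
   rate [g 2], unless it lies on the spine. *)
Lemma prod_edge_mult_le (g_ge0 : forall m, 0 <= g m) :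
  \prod_e g (edge_mult e) <= \prod_(u in S) (g 2%N ^+ 2 * g 1%N ^+ minn (N u) n).
Proof.
apply: (@le_trans _ _ (\prod_e \prod_(p in edge_ends e) c p)).
  by apply: ler_prod => e _; rewrite g_ge0 edge_charge.
have -> : \prod_e \prod_(p in edge_ends e) c p =
    \prod_(p : V * V | (p.1 \in S) && tree_adj N p.1 p.2) c p.
  rewrite [RHS](partition_big (fun p => [set p.1; p.2]%SET) xpredT)//=.
  by apply: eq_bigr => e _; apply: eq_bigl => p; rewrite inE andbA.
rewrite -(pair_big_dep (mem S) (tree_adj N) (fun u w => c (u, w))) /=.
apply: ler_prod => u _; apply/andP; split.
  by apply: prodr_ge0 => w _; rewrite /c; case: ifP.
rewrite (bigID (parent u)) /= mulrC; apply: ler_pM.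
- by apply: prodr_ge0 => w _; rewrite /c; case: ifP.
- by apply: prodr_ge0 => w _; rewrite /c; case: ifP.
- rewrite (eq_bigr (fun=> g 2%N)); last by move=> w /andP[_ /negPf h]; rewrite /c /= h.
  by rewrite prodr_const ler_weXn2l// card_nonchildren.
- rewrite (eq_bigr (fun=> g 1%N)); last by move=> w /andP[_ h]; rewrite /c /= h.
  by rewrite prodr_const ler_weXn2l// card_children.
Qed.

End EdgeCharging.

(** * Pathwise bound on the moment product *)

Section WeightBound.
Variables (R : realType) (l n r : nat) (d eps beta lam : R) (s : nat).
Local Notation V := (vertex l n r).
Local Notation word := ({bseq r of 'I_n}).
Variables (N : V -> nat) (J : {set V} -> R).
Hypotheses (eps01 : 0 < eps < 1) (d_ge1 : 1 <= d) (s_le : s%:R <= lam).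

Local Notation q0 := (1 - eps / 4).
Local Notation A := (calA beta (tree_adj N) J).
Local Notation vw := (vweight d eps beta (tree_adj N) J).
(* The factor making [1 + tilt * exp (lam * calA u)] dominate the [s]-th power of
   the normalised vertex weight. *)
Definition tilt : R := (2 * d) ^+ s * expR s%:R * expR (- (lam * (1 - eps / 2))).
Let tau u := 1 + tilt * expR (lam * A u).

Let eps_gt0 : 0 < eps. Proof. by case/andP: eps01. Qed.
Let eps_lt1 : eps < 1. Proof. by case/andP: eps01. Qed.
Let q0_gt0 : 0 < q0. Proof. by have := eps_lt1; lra. Qed.
Let d_ge0 : 0 <= d. Proof. exact: le_trans d_ge1. Qed.

Lemma tilt_ge0 : 0 <= tilt.
Proof. by rewrite !mulr_ge0 ?expR_ge0 ?exprn_ge0 ?mulr_ge0. Qed.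

Lemma Gamma_ge0 e : 0 <= Gamma beta J e.
Proof. by rewrite divr_ge0// addr_ge0 ?expR_ge0. Qed.

Lemma calA_ge0 u : 0 <= A u.
Proof. by apply: sumr_ge0 => w _; exact: Gamma_ge0. Qed.

Lemma vweight_ge u : 2 <= d -> q0 <= vw u.
Proof.
move=> d2; rewrite /vweight; case: ifPn => //; rewrite -ltNge => h.
have : d * (1 - eps / 2) <= d * A u by rewrite ler_wpM2l// ltW.
have := eps_lt1; have := eps_gt0; nra.
Qed.

Let vweight_ge0 u : 0 <= vw u.
Proof. by rewrite /vweight; case: ifPn => _; rewrite ?(ltW q0_gt0)// mulr_ge0 ?calA_ge0. Qed.

Let tau_ge0 u : 0 <= tau u.
Proof. by rewrite /tau addr_ge0 // mulr_ge0 ?tilt_ge0 ?expR_ge0. Qed.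

(* On the heavy branch x <= exp (x - 1) turns the polynomial weight into an
   exponential moment. *)
Lemma vweight_pow_le u : (vw u / q0) ^+ s <= 1 + tilt * expR (lam * A u).
Proof.
have t0 := tilt_ge0; have e0 := expR_ge0 (lam * A u).
rewrite /vweight; case: ifPn => [_|]; first by rewrite divff ?gt_eqF// expr1n lerDl mulr_ge0.
rewrite -ltNge => h; apply: (@le_trans _ _ (tilt * expR (lam * A u))); last by rewrite lerDr.
have A0 := calA_ge0 u.
(* As q0 >= 1/2, replacing d by 2 d absorbs the normalisation. *)
apply: (@le_trans _ _ ((2 * d) ^+ s * A u ^+ s)).
  rewrite -exprMn lerXn2r ?nnegrE ?divr_ge0 ?mulr_ge0 ?(ltW q0_gt0)//.
  rewrite ler_pdivrMr//; have dA : 0 <= d * A u by rewrite mulr_ge0.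
  have := eps_lt1; nra.
rewrite /tilt -!mulrA ler_wpM2l ?exprn_ge0 ?mulr_ge0// -!expRD.
apply: (@le_trans _ _ (expR (A u - 1) ^+ s)).
  rewrite lerXn2r ?nnegrE ?expR_ge0//; have := expR_ge1Dx (A u - 1); lra.
(* On this branch A u exceeds 1 - eps/2, so raising the slope from s to lam increases the
   exponent. *)
rewrite -expRM_natl ler_expR.
have : s%:R * (A u - (1 - eps / 2)) <= lam * (A u - (1 - eps / 2)).
  by rewrite ler_wpM2r// subr_ge0 ltW.
have : (0:R) <= s%:R by [].
have := eps_gt0; nra.
Qed.

Local Notation W := (Wmax d eps beta (tree_adj N) J r (@spine l n r)).
Local Notation q := (q0 ^+ s).

(** A maximum is one of its terms or its default, here the path of length 0; in both cases
    [offpath_word] supplies the word. *)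
Lemma Wmax_word i : exists2 w : word, in_tree N (i, w) &
  W i = \prod_(b : word | prefix b w) vw (i, b).
Proof.
rewrite /Wmax; apply: (big_ind (fun x => exists2 w : word, in_tree N (i, w) &
  x = \prod_(b : word | prefix b w) vw (i, b))).
- have [w tw e] := @offpath_word l n r N i [::] isT; exists w => //.
  rewrite big_prefix /pweight e big_map -/(index_iota 0 (size w).+1).
  by rewrite big_mkord.
- by move=> x y hx hy; case: (leP x y).
- move=> p hp; have [w tw e] := offpath_word hp; exists w => //.
  rewrite big_prefix /pweight e big_map -/(index_iota 0 (size w).+1).
  by rewrite big_mkord.
Qed.

Lemma Wmax_ge i : 2 <= d -> q0 <= W i.
Proof.
move=> d2; apply: (@le_trans _ _ (pweight d eps beta (tree_adj N) J [:: spine n r i])).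
  by rewrite /pweight big_seq1 vweight_ge.
rewrite /Wmax; elim/big_rec: _ => // p x _ h; by rewrite le_max h orbT.
Qed.

Let term i (w : word) : R :=
  (in_tree N (i, w))%:R * (q ^+ size w * \prod_(b : word | prefix b w) tau (i, b)).

Let term_ge0 i w : 0 <= term i w.
Proof.
rewrite mulr_ge0// mulr_ge0 ?exprn_ge0 ?(ltW q0_gt0)//.
by apply: prodr_ge0.
Qed.

(** The maximising word is one term of the sum. Its path has |w| + 1 vertices; dividing W by one q0
    and normalising every vertex leaves q0 ^ |w|, the decay that makes the sum over words
    converge. *)
Lemma Wmax_pow_le i : (W i / q0) ^+ s <= \sum_w term i w.
Proof.
have [w tw ->] := Wmax_word i.
apply: (@le_trans _ _ (term i w)); last first.
  by rewrite (bigD1 w)//= lerDl sumr_ge0.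
rewrite /term tw mul1r !big_prefix.
have -> : (\prod_(j < (size w).+1) vw (i, word_take w j)) / q0 =
   q0 ^+ size w * \prod_(j < (size w).+1) (vw (i, word_take w j) / q0).
  rewrite big_split /= prodr_const card_ord mulrCA exprVn exprS invfM.
  by rewrite [q0 ^+ _ * _]mulrCA divff ?mulr1// expf_neq0// gt_eqF.
rewrite exprMn -exprM mulnC exprM ler_wpM2l ?exprn_ge0 ?(ltW q0_gt0)//.
rewrite -prodrXl; apply: ler_prod => j _.
by rewrite exprn_ge0 ?divr_ge0 ?(ltW q0_gt0)//= vweight_pow_le.
Qed.

(** Regrouping by edges puts each coupling into a single factor, the form that independence
    requires. *)
Lemma prod_expR_calA (S : {set V}) : \prod_(u in S) expR (lam * A u) =
  \prod_e expR (lam * Gamma beta J e) ^+ edge_mult N S e.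
Proof.
transitivity (\prod_(u in S) \prod_(w | tree_adj N u w)
    expR (lam * Gamma beta J [set u; w]%SET)).
  by apply: eq_bigr => u _; rewrite /calA mulr_sumr expR_sum.
rewrite pair_big_dep /= (partition_big (fun p => [set p.1; p.2]%SET) xpredT)//=.
apply: eq_bigr => e _; rewrite /edge_mult -prodr_const.
by apply: eq_big => [p|p /andP[_ /eqP ->]//]; rewrite inE andbA.
Qed.

(** The share of the event that all words of [f] lie in the tree which concerns the offspring number
    of [u] alone; this lets the event factor over vertices. *)
Definition compatible (f : {ffun 'I_l.+1 -> word}) (u : V) (k : nat) : bool :=
  [forall k0 : 'I_n, prefix (rcons u.2 k0) (f u.1) ==> (k0 < k)%N].

Definition on_words (f : {ffun 'I_l.+1 -> word}) : {set V} :=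
  [set u : V | prefix u.2 (f u.1)]%SET.

Lemma prod_in_tree_le (f : {ffun 'I_l.+1 -> word}) :
  \prod_i (in_tree N (i, f i))%:R <= \prod_u (compatible f u (N u))%:R :> R.
Proof.
have [/existsP[i /negPf ni]|/existsPn h] := boolP [exists i, ~~ in_tree N (i, f i)].
  by rewrite (bigD1 i)//= ni mul0r prodr_ge0.
rewrite [leRHS]big1 ?prodr_ile1// => [i _|u _]; first by rewrite ler0n lern1 leq_b1.
suff -> : compatible f u (N u) by [].
apply/forallP => k; apply/implyP => pk.
have := h u.1; rewrite negbK => /forallP/(_ u)/forallP/(_ k).
by rewrite eqxx pk.
Qed.

(** Expanding the product of sums chooses a word [f i] for each spine vertex; expanding the product
    of the tau u chooses the set [S] of vertices contributing their exponential term. *)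
Lemma prod_Wmax_pow_le : \prod_i (W i / q0) ^+ s <=
  \sum_(f : {ffun 'I_l.+1 -> word}) \sum_(S : {set V})
    (\prod_i q ^+ size (f i)) *
    (\prod_u ((compatible f u (N u))%:R *
       (if u \in S then (u \in on_words f)%:R * tilt else 1))) *
    \prod_e expR (lam * Gamma beta J e) ^+ edge_mult N S e.
Proof.
apply: (@le_trans _ _ (\prod_i \sum_w term i w)).
  apply: ler_prod => i _; rewrite Wmax_pow_le andbT exprn_ge0// divr_ge0 ?(ltW q0_gt0)//.
  by have [w _ ->] := Wmax_word i; apply: prodr_ge0.
rewrite bigA_distr_bigA /=; apply: ler_sum => f _.
have -> : \prod_i term i (f i) = \prod_i (in_tree N (i, f i))%:R *
    (\prod_i q ^+ size (f i)) * \prod_(u in on_words f) tau u.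
  rewrite /term big_split /= big_split /= mulrA; congr (_ * _).
  rewrite (pair_big_dep xpredT (fun i (b : word) => prefix b (f i))
    (fun i b => tau (i, b))) /=.
  by apply: eq_big => [[i b]|[i b] _] //=; rewrite inE.
apply: (@le_trans _ _ (\prod_u (compatible f u (N u))%:R *
    (\prod_i q ^+ size (f i)) * \prod_(u in on_words f) tau u)).
  rewrite ler_wpM2r ?prodr_ge0// ler_wpM2r ?prod_in_tree_le// prodr_ge0// => i _.
  by rewrite !exprn_ge0// ltW.
have -> : \prod_(u in on_words f) tau u = \prod_u
    ((u \in on_words f)%:R * tilt * expR (lam * A u) + 1).
  rewrite big_mkcond; apply: eq_bigr => u _; rewrite /tau addrC.
  by case: (u \in _); rewrite ?mul1r// !mul0r add0r.
rewrite bigA_distr /= mulr_sumr le_eqVlt; apply/orP; left; apply/eqP.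
apply: eq_bigr => S _; rewrite -prod_expR_calA [X in _ = _ * X * _]big_split /=.
rewrite -[in LHS]mulrA mulrCA -!mulrA; congr (_ * (_ * _)).
rewrite [X in _ = _ * X]big_mkcond -big_split /=; apply: eq_bigr => u _.
by case: (u \in S); rewrite ?mulr1// mulrA.
Qed.

End WeightBound.

(** * Measurability of the block events *)

Section GammaFunction.
Variables (R : realType) (beta : R).

Definition gamma_fun (x : R) : R := `|1 - expR (beta * x)| / (1 + expR (beta * x)).

Lemma measurable_gamma_fun : measurable_fun setT gamma_fun.
Proof.
apply: continuous_measurable_fun => x.
have ce : {for x, continuous (fun x : R => expR (beta * x))}.
  apply: (@continuous_comp _ _ _ (fun x : R => beta * x) expR); last exact: continuous_expR.
  by apply: cvgM; [exact: cvg_cst|exact: cvg_id].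
apply: cvgM.
  apply: (@continuous_comp _ _ _ (fun x : R => 1 - expR (beta * x)) Num.Def.normr); last exact: norm_continuous.
  by apply: cvgB; [exact: cvg_cst|exact: ce].
apply: cvgV; first by rewrite gt_eqF// addr_gt0 ?expR_gt0.
by apply: cvgD; [exact: cvg_cst|exact: ce].
Qed.

End GammaFunction.

Section BlockMeasurability.
Context (R : realType) (disp : measure_display) (Om : measurableType disp).
Implicit Type I : finType.

Lemma measurable_forallb I (b : I -> Om -> bool) :
  (forall i, measurable_fun setT (b i)) ->
  measurable_fun setT (fun x => [forall i, b i x]).
Proof.
move=> mb; apply: (measurable_fun_bool true).
rewrite setTI (_ : _ @^-1` _ = \bigcap_(i in setT) (b i @^-1` [set true])).
  apply: fin_bigcap_measurable => // i _.
  by rewrite -[X in measurable X]setTI; exact: mb.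
apply/seteqP; split => x /=; first by move=> /forallP h i _; exact: h.
by move=> h; apply/forallP => i; exact: h.
Qed.

Lemma measurable_sum_cond I (P : pred I) (h : I -> Om -> R) :
  (forall i, measurable_fun setT (h i)) ->
  measurable_fun setT (fun x => \sum_(i | P i) h i x).
Proof. by move=> mh; under eq_fun do rewrite -big_filter; exact: measurable_sum. Qed.

Lemma measurable_prod_cond I (P : pred I) (h : I -> Om -> R) :
  (forall i, measurable_fun setT (h i)) ->
  measurable_fun setT (fun x => \prod_(i | P i) h i x).
Proof. by move=> mh; under eq_fun do rewrite -big_filter; apply: measurable_prod. Qed.

Lemma measurable_bigmax_cond I (P : pred I) (h0 : Om -> R) (h : I -> Om -> R) :
  measurable_fun setT h0 -> (forall i, measurable_fun setT (h i)) ->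
  measurable_fun setT (fun x => \big[Num.max/h0 x]_(i | P i) h i x).
Proof.
move=> mh0 mh; under eq_fun do rewrite -big_filter.
elim: [seq _ <- _ | _] => [|i s IH]; first by under eq_fun do rewrite big_nil.
by under eq_fun do rewrite big_cons; exact: measurable_maxr.
Qed.

Variables (V : finType) (d eps beta : R) (adj : rel V) (J : {set V} -> Om -> R).
Hypothesis mJ : forall e, measurable_fun setT (J e).
Variables (l r : nat) (v : 'I_l.+1 -> V).
Let J_at (x : Om) (e : {set V}) : R := J e x.

Let mvweight u : measurable_fun setT (fun x => vweight d eps beta adj (J_at x) u).
Proof.
have mA : measurable_fun setT (fun x => calA beta adj (J_at x) u).
  apply: measurable_sum_cond => w.
  exact: (measurableT_comp (measurable_gamma_fun beta) (mJ _)).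
apply: measurable_fun_if => //; first exact: measurable_fun_ler.
by apply: measurable_funTS; exact: measurable_funM.
Qed.

Let mpweight s : measurable_fun setT (fun x => pweight d eps beta adj (J_at x) s).
Proof. by apply: measurable_prod => u _; exact: mvweight. Qed.

Let mWmax i : measurable_fun setT (fun x => Wmax d eps beta adj (J_at x) r v i).
Proof. by apply: measurable_bigmax_cond => [|p]; exact: mpweight. Qed.

Lemma measurable_left_block j :
  measurable_fun setT (fun x => left_block d eps beta adj (J_at x) r v j).
Proof.
apply: measurable_forallb => t; case: (t <= j)%N => //=.
by apply: measurable_fun_ltr => //; exact: measurable_prod_cond.
Qed.

Lemma measurable_right_block j :
  measurable_fun setT (fun x => right_block d eps beta adj (J_at x) r v j).
Proof.
apply: measurable_forallb => t; case: (j <= t)%N => //=.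
by apply: measurable_fun_ltr => //; exact: measurable_prod_cond.
Qed.

End BlockMeasurability.

Section TruncatedTree.
Variables (l n r : nat).
Local Notation V := (vertex l n r).

(** Child labels are below n, so cutting offspring numbers at n keeps the graph and leaves finitely
    many shapes. *)
Lemma tree_adj_trunc (N : V -> nat) : tree_adj N = tree_adj (fun u => minn (N u) n).
Proof.
suff e u : in_tree N u = in_tree (fun u => minn (N u) n) u.
  by apply/funext => u; apply/funext => w; rewrite /tree_adj !e.
apply: eq_forallb => a; apply: eq_forallb => k; congr (_ ==> _).
by rewrite leq_min ltn_ord andbT.
Qed.

Context (R : realType) (disp : measure_display) (Om : measurableType disp).
Variables (P : probability Om R) (d eps beta : R).
Variables (N : V -> {RV P >-> nat}) (J : {set V} -> {RV P >-> R}).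

Definition offspring_at (x : Om) : {ffun V -> 'I_n.+1} :=
  [ffun u => inord (minn (N u x) n)].

Lemma offspring_atE x u : offspring_at x u = minn (N u x) n :> nat.
Proof. by rewrite ffunE inordK// ltnS geq_minr. Qed.

Lemma tree_adj_at x : tree_adj (fun u => N u x) = tree_adj (fun u => offspring_at x u : nat).
Proof. by rewrite tree_adj_trunc; congr tree_adj; apply/funext => u; rewrite offspring_atE. Qed.

Lemma measurable_offspring_at (nu : {ffun V -> 'I_n.+1}) :
  measurable (offspring_at @^-1` [set nu]).
Proof.
rewrite (_ : _ @^-1` _ =
   \bigcap_(u in setT) (N u @^-1` [set m | minn m n = nu u])).
  by apply: fin_bigcap_measurable => // u _; exact: measurable_funPTI.
apply/seteqP; split => x /=; first by move=> <- u _ /=; rewrite offspring_atE.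
by move=> h; apply/ffunP => u; apply: val_inj; rewrite /= offspring_atE; exact: h.
Qed.

(** The event is split over the finitely many shapes; for a fixed shape the count is a measurable
    function of the couplings. *)
Let measurable_count (b : rel V -> ({set V} -> R) -> 'I_l.+1 -> bool) (c : R) :
  (forall adj j, measurable_fun setT (fun x => b adj (fun e => J e x) j)) ->
  measurable [set x | #|[pred j | b (tree_adj (fun u => N u x)) (fun e => J e x) j]|%:R < c].
Proof.
move=> mb; pose E (nu : {ffun V -> 'I_n.+1}) := [set x | #|[pred j | b (tree_adj (fun u => nu u : nat)) (fun e => J e x) j]|%:R < c].
rewrite (_ : [set _ | _] = \bigcup_(nu in [set: {ffun V -> 'I_n.+1}])
    (offspring_at @^-1` [set nu] `&` E nu)); last first.
  apply/seteqP; split => x /=.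
    by rewrite tree_adj_at => h; exists (offspring_at x).
  by case=> nu _ [/= e]; rewrite tree_adj_at e.
apply: fin_bigcup_measurable => // nu _; apply: measurableI.
  exact: measurable_offspring_at.
rewrite /E -[X in measurable X]setTI.
have h : measurable_fun setT (fun x => #|[pred j | b (tree_adj (fun u => nu u : nat)) (fun e => J e x) j]|%:R < c).
  apply: measurable_fun_ltr => //.
  under eq_fun do rewrite -sum1_card big_mkcond natr_sum /=.
  apply: measurable_sum => j.
  under eq_fun do rewrite inE /=.
  have -> : (fun x => (if b (tree_adj (fun u => nu u : nat)) (fun e => J e x) j then 1 else 0)%N%:R)
    = (fun x => if b (tree_adj (fun u => nu u : nat)) (fun e => J e x) j then 1 else 0) :> (Om -> R).
    by apply/funext => x; case: ifP.
  by apply: measurable_fun_if => //; exact: mb.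
by have := h measurableT [set true] I.
Qed.

Lemma measurable_few_left_blocks : measurable (few_left_blocks d eps beta N J).
Proof.
apply: (@measurable_count (fun adj J' j => left_block d eps beta adj J' r (@spine l n r) j)).
by move=> adj j; apply: measurable_left_block.
Qed.

Lemma measurable_few_right_blocks : measurable (few_right_blocks d eps beta N J).
Proof.
apply: (@measurable_count (fun adj J' j => right_block d eps beta adj J' r (@spine l n r) j)).
by move=> adj j; apply: measurable_right_block.
Qed.

End TruncatedTree.

(** * Exponential moments of a single edge *)

Section EdgeMoments.
Variables (R : realType) (beta lam : R).
Hypotheses (beta_ge0 : 0 <= beta) (lam_ge0 : 0 <= lam).
Local Notation gam := (gamma_fun beta).

Definition edge_moment (m : nat) : R :=
  fine (\int[normal_prob 0 1]_x (expR (lam * gam x) ^+ m)%:E).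

Lemma gamma_fun_ge0 x : 0 <= gam x.
Proof. by rewrite divr_ge0// addr_ge0 ?expR_ge0. Qed.

Lemma gamma_fun_le1 x : gam x <= 1.
Proof.
have e := expR_gt0 (beta * x); rewrite ler_pdivrMr ?addr_gt0// mul1r.
by apply: le_trans (ler_normB _ _) _; rewrite normr1 gtr0_norm.
Qed.

Lemma gamma_fun_le x : gam x <= beta / 2 * `|x|.
Proof.
apply: le_trans (abs_expR_ratio_le _) _.
by rewrite normrM (ger0_norm beta_ge0) mulrAC.
Qed.

Lemma measurable_expR_gamma m : measurable_fun setT (fun x => expR (lam * gam x) ^+ m).
Proof.
apply: measurable_funX; apply: measurableT_comp => //.
by apply: measurable_funM => //; exact: measurable_gamma_fun.
Qed.

Let expR_ge1 x : 1 <= expR (lam * gam x).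
Proof. by rewrite -[leLHS]expR0 ler_expR mulr_ge0 ?gamma_fun_ge0. Qed.

Let pow_ge0 m x : (0 <= (expR (lam * gam x) ^+ m)%:E)%E.
Proof. by rewrite lee_fin exprn_ge0// expR_ge0. Qed.

(** The integral is finite because [gamma_fun] is at most 1. *)
Lemma edge_momentE m :
  (\int[normal_prob 0 1]_x (expR (lam * gam x) ^+ m)%:E = (edge_moment m)%:E)%E.
Proof.
rewrite fineK// ge0_fin_numE ?integral_ge0//.
apply: (@le_lt_trans _ _ (\int[normal_prob 0 1]_x (expR lam ^+ m)%:E)%E).
  apply: ge0_le_integral => //; first (apply/measurable_EFinP; exact: measurable_expR_gamma).
  move=> x _; rewrite lee_fin lerXn2r ?nnegrE ?expR_ge0// ler_expR.
  by rewrite ler_piMr// gamma_fun_le1.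
by rewrite integral_cst//= probability_setT mule1 ltry.
Qed.

Let edge_moment_mono m m' : (m <= m')%N -> edge_moment m <= edge_moment m'.
Proof.
move=> mm; rewrite -lee_fin -!edge_momentE.
apply: ge0_le_integral => //; try (apply/measurable_EFinP; exact: measurable_expR_gamma).
by move=> x _; rewrite lee_fin ler_weXn2l.
Qed.

Lemma edge_moment0 : edge_moment 0 = 1.
Proof.
apply: EFin_inj.
rewrite -edge_momentE; under eq_integral do rewrite expr0.
by rewrite integral_cst//= probability_setT mule1.
Qed.

Lemma edge_moment1_ge1 : 1 <= edge_moment 1.
Proof. by rewrite -edge_moment0 edge_moment_mono. Qed.

Lemma edge_moment12 : edge_moment 1 <= edge_moment 2.
Proof. exact: edge_moment_mono. Qed.

Lemma edge_moment_ge0 m : 0 <= edge_moment m.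
Proof. by rewrite (le_trans ler01)// -edge_moment0 edge_moment_mono. Qed.

Lemma edge_moment_le m t : t = m%:R * lam * (beta / 2) -> t <= 1 ->
  edge_moment m <=
    1 + t * (2 * (Num.sqrt (2 * pi))^-1) + 4 * expR 2 * t ^+ 2 * Num.sqrt 2.
Proof.
move=> tE t1; have t0 : 0 <= t by rewrite tE !mulr_ge0// divr_ge0.
rewrite -lee_fin -edge_momentE.
apply: le_trans (@gaussian_expR_abs_le _ t _); last by rewrite t0.
apply: ge0_le_integral => //.
- (apply/measurable_EFinP; exact: measurable_expR_gamma).
- apply/measurable_EFinP; apply: measurableT_comp => //.
  by apply: measurable_funM => //; exact: normr_measurable.
move=> x _; rewrite lee_fin -expRM_natl ler_expR tE -!mulrA ler_wpM2l// ler_wpM2l//.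
by rewrite mulrA gamma_fun_le.
Qed.

End EdgeMoments.

(** * Expectation of one term of the expansion *)

Section TreeIntegral.
Context (R : realType) (disp : measure_display) (Om : measurableType disp).
Variables (P : probability Om R) (l n r : nat) (d beta lam : R).
Local Notation V := (vertex l n r).
Variables (N : V -> {RV P >-> nat}) (J : {set V} -> {RV P >-> R}).
Hypothesis tree : random_tree_construction d N J.
Hypotheses (lam_ge0 : 0 <= lam) (p01 : 0 <= d / n%:R <= 1).

Let integral_offspring u (k : 'I_n.+1) :
  (\int[P]_x ((minn (N u x) n == k)%:R)%:E = (binomial_pmf n (d / n%:R) k)%:E)%E.
Proof.
have [hN _ _] := tree.
pose f (m : nat) : \bar R := ((minn m n == k)%:R)%:E%E.
have f0 m : (0 <= f m)%E by rewrite lee_fin.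
transitivity (\int[distribution P (N u)]_m f m)%E.
  by rewrite ge0_integral_distribution.
rewrite (@eq_measure_integral _ _ _ _ (binomial_prob n (d / n%:R)))//; last first.
  by move=> B mB _; exact: hN.
have /andP[p0 p1] := p01.
rewrite (@integral_binomial _ n (d / n%:R) p0 p1)//.
rewrite (bigD1 k)//= big1 ?adde0 => [|j jk].
  by rewrite /f (minn_idPl _) ?eqxx ?mule1// -ltnS.
rewrite /f (minn_idPl _); last by rewrite -ltnS.
by rewrite (_ : (j == k :> nat) = false) ?mule0//; exact: negbTE.
Qed.

Let integral_edge e m :
  (\int[P]_x (expR (lam * gamma_fun beta (J e x)) ^+ m)%:E = (edge_moment beta lam m)%:E)%E.
Proof.
have [_ hJ _] := tree; rewrite -edge_momentE//.
have mJ : measurable_fun setT (J e) by [].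
rewrite -(@ge0_integral_density _ _ _ _ _ P (normal_prob 0 1) (fun=> 1) (J e) _ mJ _ _
  (fun x => expR (lam * gamma_fun beta x) ^+ m))//.
- by apply: eq_integral => x _; rewrite mul1r.
- move=> B mB; apply: etrans (hJ e B mB).
  by rewrite integral_cst ?mul1e//; exact: (measurable_funPTI (J e) mB).
- exact: measurable_expR_gamma.
Qed.

(** The indicator of the shape [nu] is a product of indicators over vertices, so the integrand is a
    product of functions of single independent variables. *)
Lemma integral_offspring_edges (nu : {ffun V -> 'I_n.+1}) (m : {set V} -> nat) :
  (\int[P]_x ((offspring_at N x == nu)%:R *
      \prod_e expR (lam * gamma_fun beta (J e x)) ^+ m e)%:E =
   ((\prod_u binomial_pmf n (d / n%:R) (nu u)) *
     \prod_e edge_moment beta lam (m e))%:E)%E.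
Proof.
have [_ _ ind] := tree.
pose Y (z : V + {set V}) (x : Om) : R := match z with
  | inl u => (minn (N u x) n == nu u)%:R
  | inr e => expR (lam * gamma_fun beta (J e x)) ^+ m e
  end.
pose ev (z : V + {set V}) : R := match z with
  | inl u => binomial_pmf n (d / n%:R) (nu u)
  | inr e => edge_moment beta lam (m e)
  end.
have FY z B : measurable B ->
    (match z with inl u => events_of (N u) | inr e => events_of (J e) end) (Y z @^-1` B).
  move=> mB; case: z => [u|e] /=.
    by exists [set k | B ((minn k n == nu u)%:R)].
  exists ((fun x => expR (lam * gamma_fun beta x) ^+ m e) @^-1` B) => //.
  by rewrite -[X in measurable X]setTI; exact: measurable_expR_gamma.
have Fm z A : (match z with inl u => events_of (N u) | inr e => events_of (J e) end) A ->
    measurable A.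
  by case: z => [u|e] [B mB <-]; exact: measurable_funPTI.
have := @integral_prod_independent _ _ _ P _ _ ind Fm Y ev.
rewrite (_ : (\prod_z ev z)%:E = ((\prod_u binomial_pmf n (d / n%:R) (nu u)) *
     \prod_e edge_moment beta lam (m e))%:E)%E; last by rewrite big_sumType.
move=> <- //; first last.
- by case=> [u|e] /=; [exact: integral_offspring|exact: integral_edge].
- by case=> [u|e] x //=; rewrite exprn_ge0// expR_ge0.
- case=> [u|e] /=.
    exact: (@measurableT_comp _ _ _ _ _ _ (fun k => (minn k n == nu u)%:R : R)).
  exact: (measurableT_comp (measurable_expR_gamma beta lam (m e))).
apply: eq_integral => x _; rewrite big_sumType /=; congr EFin; congr (_ * _).
have [<-|ne] := eqVneq (offspring_at N x) nu.
  by rewrite big1// => u _; rewrite offspring_atE eqxx.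
have /existsP[u hu] : [exists u, offspring_at N x u != nu u].
  by rewrite -negb_forall; apply: contra ne => /forallP h; apply/eqP/ffunP => u; apply/eqP.
by rewrite (bigD1 u)//= -offspring_atE val_eqE (negPf hu) mul0r.
Qed.

End TreeIntegral.

(** * Summing the expansion *)

Section MomentSum.
Variables (R : realType) (l n r : nat).
Local Notation V := (vertex l n r).
Local Notation word := ({bseq r of 'I_n}).
Variables (pm : nat -> R) (g : nat -> R) (c q : R).
Hypotheses (pm_ge0 : forall k, 0 <= pm k) (pm1 : \sum_(k < n.+1) pm k = 1).
Hypotheses (g0 : g 0%N = 1) (g1 : 1 <= g 1%N) (g12 : g 1%N <= g 2%N).
Hypotheses (g_ge0 : forall m, 0 <= g m) (c_ge0 : 0 <= c) (q_ge0 : 0 <= q).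

(** Factor of a vertex with k children: 1 if it is outside [S], the tilt with its edge charges if it
    is inside. *)
Let psi (k : nat) : R := 1 + c * (g 2%N ^+ 2 * g 1%N ^+ k).
(** [leaf_mean] belongs to the last vertex of a word. [branch_mean] belongs to an inner vertex,
    summed over the child through which the word continues, hence its factor k. *)
Definition leaf_mean : R := \sum_(k < n.+1) pm k * psi k.
Definition branch_mean : R := \sum_(k < n.+1) pm k * (k%:R * psi k).
Let a (k0 : 'I_n) : R := \sum_(k < n.+1) pm k * ((k0 < k)%N%:R * psi k).

Let psi_ge0 k : 0 <= psi k.
Proof. by rewrite addr_ge0// mulr_ge0// mulr_ge0 ?exprn_ge0. Qed.

Let a_ge0 k : 0 <= a k.
Proof. by apply: sumr_ge0 => j _; rewrite !mulr_ge0. Qed.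

Let L_ge0 : 0 <= leaf_mean.
Proof. by apply: sumr_ge0 => j _; rewrite mulr_ge0. Qed.

Let sum_a : \sum_k a k = branch_mean.
Proof.
rewrite exchange_big /=; apply: eq_bigr => k _; rewrite -mulr_sumr -mulr_suml.
congr (_ * (_ * _)).
have kn : (k <= n)%N by rewrite -ltnS.
rewrite -[in RHS](card_ord k) -sum1_card natr_sum (big_ord_widen n (fun=> 1) kn).
by rewrite [RHS]big_mkcond; apply: eq_bigr => j _; case: (j < k)%N.
Qed.

Let T (f : {ffun 'I_l.+1 -> word}) (u : V) : R :=
  \sum_(k < n.+1) pm k * ((compatible f u k)%:R *
     ((u \in on_words f)%:R * c * (g 2%N ^+ 2 * g 1%N ^+ k) + 1)).

Let T_out f u : u \notin on_words f -> T f u = 1.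
Proof.
move=> nu; rewrite -[RHS]pm1; apply: eq_bigr => k _; rewrite (negPf nu) !mul0r add0r mulr1.
suff -> : compatible f u k by rewrite mulr1.
apply/forallP => k0; apply/implyP => h; case/negP: nu; rewrite inE.
exact: prefix_trans (prefix_rcons _ _) h.
Qed.

(** At a proper prefix the constraint is that the next letter is below the number of children, which
    gives [a]; the full word carries no constraint. *)
Let T_on (f : {ffun 'I_l.+1 -> word}) i : \prod_(b : word | prefix b (f i)) T f (i, b) =
  leaf_mean * \prod_(k <- f i) a k.
Proof.
set w := f i; rewrite big_prefix big_ord_recr /= mulrC; congr (_ * _).
  apply: eq_bigr => k _; rewrite inE /= prefix_take mul1r addrC.
  suff -> : compatible f (i, word_take w (size w)) k by rewrite mul1r.
  apply/forallP => k0; apply/implyP => /= /size_prefix.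
  by rewrite size_rcons take_size ltnn.
rewrite (big_tnth _ _ (f i)); apply: eq_bigr => j _; apply: eq_bigr => k _.
rewrite inE /= prefix_take mul1r [in LHS]addrC; congr (_ * (_%:R * _)).
set k0 := tnth _ j; congr nat_of_bool; have jw : (j < size w)%N := ltn_ord j.
have e : take j.+1 w = rcons (take j w) k0.
  rewrite (take_nth k0)//; congr rcons.
  by apply/esym; exact: (tnth_nth k0 (in_tuple (f i)) j).
apply/forallP/idP => [/(_ k0)|kk k1].
  by rewrite /= -e prefix_take.
apply/implyP; rewrite /= prefixE size_rcons size_takel ?(ltnW jw)// e.
by rewrite eqseq_rcons eqxx /= => /eqP <-.
Qed.

Let prod_T (f : {ffun 'I_l.+1 -> word}) : \prod_u T f u = \prod_i (leaf_mean * \prod_(k <- f i) a k).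
Proof.
rewrite (bigID (mem (on_words f))) /= [X in _ * X]big1 ?mulr1; last exact: T_out.
under [RHS]eq_bigr do rewrite -T_on.
rewrite [RHS](pair_big_dep xpredT (fun i (b : word) => prefix b (f i))
  (fun i b => T f (i, b))) /=.
by apply: eq_big => [[i b]|[i b] _] //=; rewrite inE.
Qed.

(** With edges charged to vertices, the sums over [nu] and [S] factor over vertices and the sum over
    [f] over the spine. Each spine vertex then contributes [leaf_mean] times a geometric series of
    ratio [q * branch_mean], which is at most 2. *)
Lemma moment_sum_le : q * branch_mean <= 1 / 2 ->
  \sum_(nu : {ffun V -> 'I_n.+1}) \sum_(f : {ffun 'I_l.+1 -> word}) \sum_(S : {set V})
    (\prod_i q ^+ size (f i)) *
    (\prod_u ((compatible f u (nu u))%:R *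
       (if u \in S then (u \in on_words f)%:R * c else 1))) *
    ((\prod_u pm (nu u)) * \prod_e g (edge_mult (fun u => nu u : nat) S e))
  <= (2 * leaf_mean) ^+ l.+1.
Proof.
move=> qD.
apply: (@le_trans _ _ (\sum_(f : {ffun 'I_l.+1 -> word}) (\prod_i q ^+ size (f i)) *
    \prod_u T f u)); last first.
  under eq_bigr do rewrite prod_T -big_split /=.
  rewrite -(bigA_distr_bigA (fun i (w : word) =>
    q ^+ size w * (leaf_mean * \prod_(k <- w) a k))) /=.
  rewrite prodr_const card_ord lerXn2r ?nnegrE ?mulr_ge0//.
    by apply: sumr_ge0 => w _; rewrite !mulr_ge0 ?exprn_ge0// prodr_ge0.
  have -> : \sum_(w : word) q ^+ size w * (leaf_mean * \prod_(k <- w) a k) =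
      leaf_mean * \sum_(w : word) \prod_(k <- w) (q * a k).
    rewrite mulr_sumr; apply: eq_bigr => w _; rewrite mulrCA; congr (_ * _).
    by rewrite big_split /= big_const_seq count_predT iter_mulr_1.
  rewrite mulrC ler_wpM2r//; apply: sum_bseq_le => [k|]; first by rewrite mulr_ge0.
  by rewrite -mulr_sumr sum_a.
rewrite exchange_big /=; apply: ler_sum => f _.
have q0' : 0 <= \prod_i q ^+ size (f i) by apply: prodr_ge0 => i _; exact: exprn_ge0.
under eq_bigr => nu _ do under eq_bigr => S _ do rewrite -mulrA.
under eq_bigr => nu _ do rewrite -mulr_sumr.
rewrite -mulr_sumr ler_wpM2l// /T bigA_distr_bigA /=.
apply: ler_sum => nu _.
have -> : \prod_u (pm (nu u) * ((compatible f u (nu u))%:R *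
     ((u \in on_words f)%:R * c * (g 2%N ^+ 2 * g 1%N ^+ nu u) + 1))) =
  (\prod_u (pm (nu u) * (compatible f u (nu u))%:R)) *
  \sum_(S : {set V}) \prod_u
     (if u \in S then (u \in on_words f)%:R * c * (g 2%N ^+ 2 * g 1%N ^+ nu u) else 1).
  rewrite -bigA_distr /= -big_split /=.
  by apply: eq_bigr => u _; rewrite mulrA.
rewrite mulr_sumr; apply: ler_sum => S _.
have h := prod_edge_mult_le (fun u => nu u : nat) S g0 g1 g12 g_ge0.
rewrite [X in _ <= X](_ : _ = (\prod_u ((compatible f u (nu u))%:R *
       (if u \in S then (u \in on_words f)%:R * c else 1))) *
   ((\prod_u pm (nu u)) * \prod_(u in S) (g 2%N ^+ 2 * g 1%N ^+ nu u))); last first.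
  rewrite [\prod_(u in S) _]big_mkcond -!big_split /=; apply: eq_bigr => u _.
  by case: (u \in S); ring.
rewrite ler_wpM2l ?prodr_ge0//.
  by move=> u _; rewrite mulr_ge0//; case: ifP => // _; rewrite mulr_ge0.
rewrite ler_wpM2l ?prodr_ge0//; apply: le_trans h _.
rewrite le_eqVlt; apply/orP; left; apply/eqP; apply: eq_bigr => u _.
by rewrite (minn_idPl _)// -ltnS.
Qed.

End MomentSum.

(** * Markov's inequality for the moment *)

Section Markov.
Context (R : realType) (disp : measure_display) (Om : measurableType disp).
Variables (P : probability Om R) (l n r : nat) (d eps beta lam : R) (s : nat).
Local Notation V := (vertex l n r).
Local Notation word := ({bseq r of 'I_n}).
Variables (N : V -> {RV P >-> nat}) (J : {set V} -> {RV P >-> R}).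
Hypothesis tree : random_tree_construction d N J.
Hypotheses (eps01 : 0 < eps < 1) (d_ge1 : 1 <= d) (s_le : s%:R <= lam).
Hypotheses (p01 : 0 <= d / n%:R <= 1).

Local Notation q0 := (1 - eps / 4).
Local Notation pm := (binomial_pmf n (d / n%:R)).
Local Notation g := (edge_moment beta lam).
Local Notation c := (tilt d eps lam s).
Local Notation W x := (Wmax d eps beta (tree_adj (fun u => N u x)) (fun e => J e x) r (@spine l n r)).

(** A term of the expansion: tree shape, words and chosen vertices. Recording the shape makes the
    edge multiplicities non-random. *)
Let idx := ({ffun V -> 'I_n.+1} * ({ffun 'I_l.+1 -> word} * {set V}))%type.
Let coef (t : idx) : R :=
  (\prod_i (q0 ^+ s) ^+ size (t.2.1 i)) *
    (\prod_u ((compatible t.2.1 u (t.1 u))%:R *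
       (if u \in t.2.2 then (u \in on_words t.2.1)%:R * c else 1))).
Let mult (t : idx) := edge_mult (fun u => t.1 u : nat) t.2.2.
Let Y (t : idx) (x : Om) : R := (offspring_at N x == t.1)%:R *
  \prod_e expR (lam * gamma_fun beta (J e x)) ^+ mult t e.

Let lam_ge0 : 0 <= lam. Proof. exact: le_trans s_le. Qed.

Let coef_ge0 t : 0 <= coef t.
Proof.
have /andP[e0 e1] := eps01.
rewrite mulr_ge0 ?prodr_ge0// => [i _|u _]; first by rewrite !exprn_ge0//; lra.
by rewrite mulr_ge0//; case: ifP => // _; rewrite mulr_ge0// tilt_ge0.
Qed.

Let Y_ge0 t x : 0 <= Y t x.
Proof. by rewrite mulr_ge0// prodr_ge0// => e _; rewrite exprn_ge0// expR_ge0. Qed.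

Let measurable_Y t : measurable_fun setT (Y t).
Proof.
apply: measurable_funM.
  have -> : (fun x => (offspring_at N x == t.1)%:R) = \1_(offspring_at N @^-1` [set t.1]) :> (Om -> R).
    apply/funext => x; rewrite indicE; congr (_%:R); congr nat_of_bool.
    by apply/eqP/idP; rewrite inE.
  by apply: measurable_indic; exact: measurable_offspring_at.
apply: measurable_prod => e _.
exact: (measurableT_comp (measurable_expR_gamma beta lam (mult t e))).
Qed.

(** At [x] only the actual shape has a nonzero indicator, and its terms are those of
    [prod_Wmax_pow_le]. *)
Let prod_W_le x : \prod_i (W x i / q0) ^+ s <= \sum_t coef t * Y t x.
Proof.
rewrite tree_adj_at.
apply: le_trans (@prod_Wmax_pow_le _ _ _ _ d eps beta lam s
  (fun u => offspring_at N x u : nat) (fun e => J e x) eps01 d_ge1 s_le) _.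
rewrite le_eqVlt; apply/orP; left; apply/eqP.
rewrite -(pair_bigA _ (fun nu fS => coef (nu, fS) * Y (nu, fS) x)) /=.
rewrite (bigD1 (offspring_at N x))//= [X in _ = _ + X]big1 ?addr0; last first.
  move=> nu ne; rewrite big1// => fS _.
  by rewrite /Y /= eq_sym (negPf ne) mul0r mulr0.
rewrite -(pair_bigA _ (fun f S => coef (offspring_at N x, (f, S)) *
  Y (offspring_at N x, (f, S)) x)) /=.
apply: eq_bigr => f _; apply: eq_bigr => S _.
by rewrite /Y /= eqxx mul1r.
Qed.

(** The indicator of [E] is at most [A] times the product, hence at most [A] times the expansion,
    which is integrated term by term. *)
Lemma probability_le_moment (E : set Om) (A : R) : measurable E -> 0 <= A ->
  (forall x, E x -> 1 <= A * \prod_i (W x i / q0) ^+ s) ->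
  (q0 ^+ s) * branch_mean n pm g c <= 1 / 2 ->
  (P E <= (A * (2 * leaf_mean n pm g c) ^+ l.+1)%:E)%E.
Proof.
move=> mE A0 hE qD.
have -> : P E = (\int[P]_x (\1_E x)%:E)%E by rewrite integral_indic// setIT.
apply: (@le_trans _ _ (\int[P]_x (\sum_t (A * coef t * Y t x)%:E))%E).
  apply: ge0_le_integral => //.
  - exact/measurable_EFinP/measurable_indic.
  - by apply: emeasurable_sum => t; apply/measurable_EFinP; exact: measurable_funM.
  move=> x _; rewrite sumEFin lee_fin.
  have -> : \sum_t A * coef t * Y t x = A * \sum_t coef t * Y t x.
    by rewrite mulr_sumr; apply: eq_bigr => t _; rewrite mulrA.
  have sum_ge0 : 0 <= \sum_t coef t * Y t x by apply: sumr_ge0 => t _; rewrite mulr_ge0.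
  rewrite indicE; case: (boolP (x \in E)) => [xE|_]; last by rewrite mulr_ge0.
  apply: le_trans (hE x _) _; first by move: xE; rewrite inE.
  by rewrite ler_wpM2l// prod_W_le.
rewrite ge0_integral_sum//; last 2 first.
- by move=> t; apply/measurable_EFinP; exact: measurable_funM.
- by move=> t x _; rewrite lee_fin; apply: mulr_ge0 => //; exact: mulr_ge0.
under eq_bigr => t _.
  under eq_integral do rewrite EFinM.
  rewrite ge0_integralZl//; last 3 first.
  + exact/measurable_EFinP.
  + by move=> x _; rewrite lee_fin.
  + by rewrite lee_fin mulr_ge0.
  rewrite (integral_offspring_edges beta tree lam_ge0 p01 t.1 (mult t)) -EFinM.
  over.
rewrite sumEFin lee_fin.
have /andP[p0 p1] := p01.
have pm_ge0 k : 0 <= pm k by exact: binomial_pmf_ge0.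
have pm1 : \sum_(k < n.+1) pm k = 1.
  rewrite /binomial_pmf; under eq_bigr do rewrite mulrC.
  by rewrite -exprDn addrC unstable.add_onemK expr1n.
apply: le_trans (ler_wpM2l A0 (moment_sum_le l r pm_ge0 pm1 (edge_moment0 beta lam_ge0)
  (edge_moment1_ge1 beta lam_ge0) (edge_moment12 beta lam_ge0)
  (edge_moment_ge0 beta lam_ge0) (tilt_ge0 eps lam s d_ge1) _ qD)); last first.
  by rewrite exprn_ge0//; have /andP[] := eps01; lra.
rewrite le_eqVlt; apply/orP; left; apply/eqP.
under eq_bigr do rewrite -mulrA; rewrite -mulr_sumr; congr (_ * _).
rewrite -(pair_bigA _ (fun nu fS => coef (nu, fS) * (\prod_u pm (nu u) * \prod_e g (mult (nu, fS) e)))) /=.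
apply: eq_bigr => nu _.
by rewrite -(pair_bigA _ (fun f S => coef (nu, (f, S)) * (\prod_u pm (nu u) * \prod_e g (mult (nu, (f, S)) e)))).
Qed.

End Markov.

(** * Binomial generating functions *)

Section BinomialMeans.
Variables (R : realType) (n : nat) (d : R).
Hypotheses (d_ge1 : 1 <= d) (dn : d <= n%:R).
Local Notation pm := (binomial_pmf n (d / n%:R)).

Let n_gt0 : 0 < n%:R :> R. Proof. exact: lt_le_trans (lt_le_trans ltr01 d_ge1) dn. Qed.
Let d_gt0 : 0 < d. Proof. exact: lt_le_trans d_ge1. Qed.

Lemma binomial_ratio01 : 0 <= d / n%:R <= 1.
Proof. by rewrite divr_ge0 ?(ltW d_gt0) ?(ltW n_gt0)//= ler_pdivrMr// mul1r. Qed.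

(** The generating function is (1 + p (h - 1)) ^ n by the binomial theorem; then 1 + y <= exp y and
    n p = d. *)
Lemma binomial_pgf_le (h : R) : 0 <= h -> \sum_(k < n.+1) pm k * h ^+ k <= expR (d * (h - 1)).
Proof.
move=> h0; have /andP[p0 p1] := binomial_ratio01; set p := d / n%:R in p0 p1 *.
have pE : n%:R * p = d by rewrite mulrC divfK ?gt_eqF.
clearbody p.
have -> : \sum_(k < n.+1) binomial_pmf n p k * h ^+ k = ((1 - p) + p * h) ^+ n.
  rewrite exprDn; apply: eq_bigr => k _; 
  rewrite /binomial_pmf /unstable.onem mulrnAl exprMn mulrA.
  by rewrite [p ^+ k * _]mulrC.
apply: (@le_trans _ _ (expR (p * (h - 1)) ^+ n)).
  have ph : 0 <= p * h by rewrite mulr_ge0.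
  rewrite lerXn2r ?nnegrE ?expR_ge0//; first by lra.
  by have := expR_ge1Dx (p * (h - 1)); lra.
by rewrite -expRM_natl ler_expR mulrA pE.
Qed.

(** Bernoulli's inequality turns the factor k into a power, so a mean weighted by k reduces to the
    generating function at (1 + 1/d) h. *)
Lemma natr_le_pow (k : nat) : k%:R <= d * (1 + d^-1) ^+ k.
Proof.
have h : 1 + k%:R * d^-1 <= (1 + d^-1) ^+ k.
  elim: k => [|k IH]; first by rewrite mul0r addr0 expr0.
  have i0 : 0 <= d^-1 by rewrite invr_ge0 ltW.
  have k0 : 0 <= k%:R * d^-1 ^+ 2 by rewrite mulr_ge0// exprn_ge0.
  rewrite exprS -natr1; apply: (@le_trans _ _ ((1 + d^-1) * (1 + k%:R * d^-1))); first nra.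
  by rewrite ler_wpM2l// addr_ge0.
have := ler_wpM2l (ltW d_gt0) h; apply: le_trans.
by rewrite mulrDr mulrCA divff ?gt_eqF// !mulr1 lerDr ltW.
Qed.

Lemma binomial_mean_pgf_le (h : R) : 0 <= h ->
  \sum_(k < n.+1) pm k * (k%:R * h ^+ k) <= d * expR (d * (h - 1) + h).
Proof.
move=> h0; have i0 : 0 <= 1 + d^-1 by rewrite addr_ge0// invr_ge0 ltW.
apply: (@le_trans _ _ (d * \sum_(k < n.+1) pm k * ((1 + d^-1) * h) ^+ k)).
  rewrite mulr_sumr; apply: ler_sum => k _.
  rewrite [leRHS]mulrCA ler_wpM2l ?binomial_pmf_ge0 ?binomial_ratio01//.
  by rewrite exprMn mulrA ler_wpM2r ?exprn_ge0// natr_le_pow.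
rewrite ler_wpM2l ?(ltW d_gt0)//; apply: le_trans (binomial_pgf_le _) _; first exact: mulr_ge0.
rewrite ler_expR le_eqVlt; apply/orP; left; apply/eqP; field; by rewrite gt_eqF.
Qed.

Variables (g : nat -> R) (c : R).
Hypotheses (g_ge0 : forall m, 0 <= g m) (c_ge0 : 0 <= c).

Lemma leaf_mean_le : leaf_mean n pm g c <= 1 + c * g 2%N ^+ 2 * expR (d * (g 1%N - 1)).
Proof.
rewrite /leaf_mean (eq_bigr (fun k : 'I_n.+1 => pm k * 1 ^+ k +
   c * g 2%N ^+ 2 * (pm k * g 1%N ^+ k))); last first.
  move=> k _; rewrite expr1n.
  by move: (pm k) (g 1%N ^+ k) (g 2%N ^+ 2) (k%:R : R) => x y z w; ring.
rewrite big_split /= -mulr_sumr; apply: lerD.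
  by have := binomial_pgf_le (ler01 : (0:R) <= 1); rewrite subrr mulr0 expR0.
by rewrite ler_wpM2l ?binomial_pgf_le// mulr_ge0// exprn_ge0.
Qed.

Lemma branch_mean_le : branch_mean n pm g c <=
  d * expR 1 + c * g 2%N ^+ 2 * (d * expR (d * (g 1%N - 1) + g 1%N)).
Proof.
rewrite /branch_mean (eq_bigr (fun k : 'I_n.+1 => pm k * (k%:R * 1 ^+ k) +
   c * g 2%N ^+ 2 * (pm k * (k%:R * g 1%N ^+ k)))); last first.
  move=> k _; rewrite expr1n.
  by move: (pm k) (g 1%N ^+ k) (g 2%N ^+ 2) (k%:R : R) => x y z w; ring.
rewrite big_split /= -mulr_sumr; apply: lerD.
  by have := binomial_mean_pgf_le (ler01 : (0:R) <= 1); rewrite subrr mulr0 add0r.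
by rewrite ler_wpM2l ?binomial_mean_pgf_le// mulr_ge0// exprn_ge0.
Qed.

End BinomialMeans.

(** * Elementary numerical inequalities *)

Section Constants.
Variable R : realType.
Implicit Types (x y : R).

Lemma expR1_le4 : expR 1 <= 4 :> R.
Proof.
have h : (1 : R) = 2^-1 + 2^-1 by lra.
have e2 : expR (2^-1) <= 2 :> R.
  have := expR_ge1Dx (- 2^-1 : R); rewrite expRN => e.
  have e0 := expR_gt0 (2^-1 : R).
  have := ler_wpM2r (ltW e0) e; rewrite mulVf ?gt_eqF//; lra.
rewrite h expRD; have := expR_ge0 (2^-1 : R); nra.
Qed.

Lemma expR_ge_sqr y : 0 <= y -> y ^+ 2 / 4 <= expR y.
Proof.
move=> y0; have e := expR_ge1Dx (y / 2).
have -> : expR y = expR (y / 2) * expR (y / 2) by rewrite -expRD; congr expR; lra.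
have e0 := expR_ge0 (y / 2); nra.
Qed.

Lemma mul_expRN_le y z : 2 * z <= y -> z * expR (- y) <= 1 / 2.
Proof.
move=> h; rewrite expRN ler_pdivrMr ?expR_gt0//.
by have := expR_ge1Dx y; lra.
Qed.

(** Here x stands for d^(1/12): the gain is of order x^12, while log ((2 d)^s e^s) is at most (2 +
    12 x) s, of order x^10. *)
Lemma exponent_gap (x s a K : R) : 1 <= x -> s <= 2 * x ^+ 9 -> 0 <= K ->
  4 * (28 + K) <= a * x -> K <= a / 4 * x ^+ 12 - (2 + 12 * x) * s.
Proof.
move=> x1 sx K0 h.
have x9 : 1 <= x ^+ 9 by rewrite exprn_ege1.
have x11 : 1 <= x ^+ 11 by rewrite exprn_ege1.
have e11 : x ^+ 11 = x * x * x ^+ 9 by ring.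
have h1 : (2 + 12 * x) * s <= (2 + 12 * x) * (2 * x ^+ 9) by rewrite ler_wpM2l//; lra.
have h2 : 4 * (28 + K) * x ^+ 11 <= a * x * x ^+ 11 by rewrite ler_wpM2r//; lra.
have e12 : a * x * x ^+ 11 = a * x ^+ 12 by ring.
have h3 : (2 + 12 * x) * (2 * x ^+ 9) <= 28 * x ^+ 11.
  rewrite e11; have : (2 + 12 * x) * 2 <= 28 * (x * x) by nra.
  move=> h3; have := ler_wpM2r (le_trans ler01 x9) h3; lra.
have h4 : K <= K * x ^+ 11 by rewrite ler_peMr.
lra.
Qed.

Lemma pow_le_expRN (eps : R) (s : nat) : 0 < eps < 1 ->
  (1 - eps / 4) ^+ s <= expR (- (eps / 4 * s%:R)).
Proof.
move=> /andP[e0 e1]; 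
  rewrite (_ : - (eps / 4 * s%:R) = s%:R * - (eps / 4)); last by ring.
  rewrite expRM_natl lerXn2r ?nnegrE ?expR_ge0//; first by lra.
by have := expR_ge1Dx (- (eps / 4)); lra.
Qed.

End Constants.

(** * Choice of the constants and estimates for large d *)

Section MomentAsymptotics.
Variables (R : realType) (eps : R).
Hypothesis eps01 : 0 < eps < 1.
Let eps_gt0 : 0 < eps. Proof. by case/andP: eps01. Qed.
Let eps_lt1 : eps < 1. Proof. by case/andP: eps01. Qed.

(** Quadratic coefficient of [gaussian_expR_abs_le]. *)
Let C : R := 4 * expR 2 * Num.sqrt 2.
(* With lam = c0 * d, the quadratic term of the Gaussian estimate is at most
   C * (3 * c0 / 2) ^ 2 = c0 * eps / 4. *)
Let c0 : R := eps / (9 * C).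
(** Each summand secures one bound of [x0_bounds]; the last three serve [exponent_gap], the decay in
    s, and s <= lam. *)
Let x0 : R := 2 + 4 * (28 + 2 * (2 + C) ^+ 2) / (c0 * eps) + 40 / eps + 2 / c0.

Let C_ge4 : 4 <= C.
Proof.
have s2 : 1 <= Num.sqrt 2 :> R by rewrite -[leLHS]sqrtr1 ler_sqrt// ler1n.
have e2 := expR_ge1Dx (2 : R); rewrite /C; nra.
Qed.

Let c0_gt0 : 0 < c0. Proof. by rewrite divr_gt0//; have := C_ge4; lra. Qed.

Let c0C : 9 * C * c0 = eps.
Proof. by rewrite /c0 mulrC divfK// gt_eqF//; have := C_ge4; lra. Qed.

Let c0_le : c0 <= 1 / 36.
Proof. by have := C_ge4; have := c0C; have := c0_gt0; have := eps_lt1; nra. Qed.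

Let x0_bounds : [/\ 2 <= x0,
  4 * (28 + 2 * (2 + C) ^+ 2) <= c0 * eps * x0, 40 <= eps * x0 & 2 <= c0 * x0].
Proof.
have p2 : 0 < c0 * eps by rewrite mulr_gt0.
have K0 : 0 <= 4 * (28 + 2 * (2 + C) ^+ 2) by have := sqr_ge0 (2 + C); lra.
have a2 : 0 <= 4 * (28 + 2 * (2 + C) ^+ 2) / (c0 * eps) by rewrite divr_ge0// ltW.
have a3 : 0 <= 40 / eps by rewrite divr_ge0// ltW.
have a4 : 0 <= 2 / c0 by rewrite divr_ge0// ltW.
split; [|rewrite [leRHS]mulrC -ler_pdivrMr//..]; rewrite /x0; move: a2 a3 a4;
  by move: (_ / (c0 * eps)) (40 / eps) (2 / c0) => u v w; lra.
Qed.

Section Large.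
Variables (x d beta : R) (n s : nat).
Hypotheses (x0x : x0 <= x) (dx : d = x ^+ 12) (beta_gt0 : 0 < beta).
Hypothesis beta_le : beta <= (1 - eps) * beta_c d.
Hypotheses (dn : d <= n%:R) (sx : x ^+ 9 <= s%:R <= 2 * x ^+ 9).

Let lam := c0 * d.
Local Notation g := (edge_moment beta lam).
Local Notation S := (Num.sqrt (2 * pi) : R).

Let x_bounds : [/\ 2 <= x,
  4 * (28 + 2 * (2 + C) ^+ 2) <= c0 * eps * x, 40 <= eps * x & 2 <= c0 * x].
Proof.
have [h1 h3 h4 h5] := x0_bounds.
have m y : 0 <= y -> y * x0 <= y * x by move=> y0; rewrite ler_wpM2l.
split; first exact: le_trans x0x.
- by apply: le_trans h3 (m _ _); rewrite mulr_ge0// ltW.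
- by apply: le_trans h4 (m _ _); rewrite ltW.
- by apply: le_trans h5 (m _ _); rewrite ltW.
Qed.

Let x_ge2 : 2 <= x. Proof. by case: x_bounds. Qed.
Let x_ge1 : 1 <= x. Proof. by have := x_ge2; lra. Qed.

Lemma large_d_ge2 : 2 <= d.
Proof.
rewrite dx; apply: le_trans x_ge2 _.
by rewrite -[leLHS]expr1 ler_weXn2l.
Qed.

Let d_gt0 : 0 < d. Proof. by have := large_d_ge2; lra. Qed.

Let S_bounds : 2 <= S <= 3.
Proof.
have p2 := @pi_ge2 R; have p4 := @pihalf_lt2 R.
have n4 : (2 : R) = Num.sqrt (2 ^+ 2) by rewrite sqrtr_sqr ger0_norm.
have n9 : (3 : R) = Num.sqrt (3 ^+ 2) by rewrite sqrtr_sqr ger0_norm.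
by rewrite {1}n4 n9 !ler_sqrt//; lra.
Qed.

Let t1 := lam * (beta / 2).

Let t1_ge0 : 0 <= t1.
Proof. by apply: mulr_ge0; [apply: mulr_ge0; exact: ltW|apply: divr_ge0 => //; exact: ltW]. Qed.

Let t1_le : t1 <= c0 * (1 - eps) * S / 2.
Proof.
have db : d * beta <= (1 - eps) * S.
  have := ler_wpM2l (ltW d_gt0) beta_le.
  by rewrite /beta_c mulrCA (mulrCA d) divff ?mulr1// gt_eqF.
have := ler_wpM2l (ltW c0_gt0) db; rewrite /t1 /lam; lra.
Qed.

Let t1_le2 : t1 <= c0 * (3 / 2).
Proof.
apply: le_trans t1_le _; have /andP[s2 s3] := S_bounds.
have : (1 - eps) * S <= 3 by have := eps_gt0; have := eps_lt1; nra.
by move=> h; have := ler_wpM2l (ltW c0_gt0) h; lra.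
Qed.

(** The bound on beta enters here: the linear term 2 t1 / sqrt (2 pi) is at most c0 (1 - eps), and
    the quadratic one adds at most c0 eps / 4. *)
Let g1_le : g 1%N - 1 <= c0 * (1 - 3 / 4 * eps).
Proof.
have /andP[s2 s3] := S_bounds.
have t11 : t1 <= 1 by have := t1_le2; have := c0_le; lra.
have := @edge_moment_le _ beta lam (ltW beta_gt0) (mulr_ge0 (ltW c0_gt0) (ltW d_gt0)) 1%N t1 _ t11.
rewrite mul1r => /(_ erefl) h.
have a1 : t1 * (2 * S^-1) <= c0 * (1 - eps).
  have Si : 0 <= 2 * S^-1 by rewrite mulr_ge0// invr_ge0; lra.
  apply: le_trans (ler_wpM2r Si t1_le) _.
  rewrite le_eqVlt; apply/orP; left; apply/eqP; field; rewrite gt_eqF//; lra.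
have a2 : 4 * expR 2 * t1 ^+ 2 * Num.sqrt 2 <= c0 * eps / 4.
  have -> : 4 * expR 2 * t1 ^+ 2 * Num.sqrt 2 = C * t1 ^+ 2 by rewrite /C; ring.
  have t2 : t1 ^+ 2 <= (c0 * (3 / 2)) ^+ 2.
    by rewrite lerXn2r// nnegrE; have := c0_gt0; lra.
  have C0 : 0 <= C by have := C_ge4; lra.
  apply: le_trans (ler_wpM2l C0 t2) _; rewrite -[in leRHS]c0C.
  by rewrite le_eqVlt; apply/orP; left; apply/eqP; field.
lra.
Qed.

Let g2_le : g 2%N <= 2 + C.
Proof.
have /andP[s2 s3] := S_bounds.
have t21 : 2 * t1 <= 1 by have := t1_le2; have := c0_le; lra.
have t2E : 2 * t1 = 2%:R * lam * (beta / 2) by rewrite /t1 mulrA.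
apply: le_trans (edge_moment_le (ltW beta_gt0) (mulr_ge0 (ltW c0_gt0) (ltW d_gt0)) t2E t21) _.
have a1 : 2 * t1 * (2 * S^-1) <= 1.
  have Si : 2 * S^-1 <= 1 by rewrite ler_pdivrMr ?mul1r//; lra.
  have Si0 : 0 <= 2 * S^-1 by rewrite mulr_ge0// invr_ge0; lra.
  have := t1_ge0; nra.
have a2 : 4 * expR 2 * (2 * t1) ^+ 2 * Num.sqrt 2 <= C.
  have -> : 4 * expR 2 * (2 * t1) ^+ 2 * Num.sqrt 2 = (2 * t1) ^+ 2 * C by rewrite /C; ring.
  rewrite ler_piMl//; first by have := C_ge4; lra.
  by rewrite exprn_ile1// mulr_ge0.
lra.
Qed.

Lemma large_s_le : s%:R <= lam.
Proof.
have /andP[_ s2] := sx; apply: le_trans s2 _; rewrite /lam dx.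
have [_ _ _ h] := x_bounds.
have x9 : 0 <= x ^+ 9 by rewrite exprn_ge0//; have := x_ge1; lra.
have -> : c0 * x ^+ 12 = c0 * x * (x * x) * x ^+ 9 by ring.
by rewrite ler_wpM2r//; have := x_ge1; nra.
Qed.

Local Notation c := (tilt d eps lam s).

(** The tilt contributes - lam (1 - eps/2) to the exponent and [g 1] at most lam (1 - 3 eps/4). The
    net - lam eps/4 beats (2 d)^s e^s and the constant bound on [g 2]. *)
Let tilt_small : c * g 2%N ^+ 2 * expR (d * (g 1%N - 1)) <= 1 / 2.
Proof.
have x0' : 0 <= x by have := x_ge1; lra.
have h2d : 2 * d <= expR (1 + 12 * x).
  rewrite expRD mulrC [leRHS]mulrC; apply: ler_pM => //; first exact: ltW.
    rewrite expRM_natl dx lerXn2r ?nnegrE ?expR_ge0//.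
    by have := expR_ge1Dx x; lra.
  by have := expR_ge1Dx (1 : R); lra.
have hc : c <= expR ((2 + 12 * x) * s%:R - lam * (1 - eps / 2)).
  rewrite /tilt expRD expRN ler_wpM2r ?invr_ge0 ?expR_ge0//.
  have -> : (2 + 12 * x) * s%:R = s%:R * (1 + 12 * x) + s%:R by ring.
  rewrite expRD ler_wpM2r ?expR_ge0// expRM_natl lerXn2r ?nnegrE ?expR_ge0//.
  by rewrite mulr_ge0// ltW.
have hg2 : g 2%N ^+ 2 <= (2 + C) ^+ 2.
  have C0 := C_ge4.
  rewrite lerXn2r ?nnegrE//; last by lra.
  by apply: edge_moment_ge0; rewrite mulr_ge0// ltW.
have hg1 : expR (d * (g 1%N - 1)) <= expR (lam * (1 - 3 / 4 * eps)).
  rewrite ler_expR; apply: le_trans (ler_wpM2l (ltW d_gt0) g1_le) _.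
  by rewrite /lam mulrA (mulrC d).
have c_ge0 : 0 <= c by apply: tilt_ge0; have := large_d_ge2; lra.
apply: (@le_trans _ _ (expR ((2 + 12 * x) * s%:R - lam * (1 - eps / 2)) * (2 + C) ^+ 2 *
   expR (lam * (1 - 3 / 4 * eps)))).
  have g20 : 0 <= g 2%N ^+ 2 by exact: sqr_ge0.
  apply: ler_pM hg1; [exact: mulr_ge0|exact: expR_ge0|exact: ler_pM].
rewrite mulrAC -expRD mulrC.
have -> : (2 + 12 * x) * s%:R - lam * (1 - eps / 2) + lam * (1 - 3 / 4 * eps) =
  - (c0 * eps / 4 * x ^+ 12 - (2 + 12 * x) * s%:R) by rewrite /lam dx; field.
apply: mul_expRN_le; apply: exponent_gap => //.
- by have /andP[] := sx.
- by rewrite mulr_ge0// sqr_ge0.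
- by have [_ ? _ _] := x_bounds.
Qed.

Lemma large_leaf_mean_le : leaf_mean n (binomial_pmf n (d / n%:R)) g c <= 3 / 2.
Proof.
have d1 : 1 <= d by have := large_d_ge2; lra.
have l0 : 0 <= lam by rewrite mulr_ge0// ltW.
apply: le_trans (leaf_mean_le d1 dn (edge_moment_ge0 beta l0) (tilt_ge0 eps lam s d1)) _.
by have := tilt_small; lra.
Qed.

Lemma large_branch_mean_le :
  (1 - eps / 4) ^+ s * branch_mean n (binomial_pmf n (d / n%:R)) g c <= 1 / 2.
Proof.
have d1 : 1 <= d by have := large_d_ge2; lra.
have l0 : 0 <= lam by rewrite mulr_ge0// ltW.
(* The untilted part gives 4 d, the tilted part at most 16 d / 2. *)
have hD : branch_mean n (binomial_pmf n (d / n%:R)) g c <= 12 * d.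
  apply: le_trans (branch_mean_le d1 dn (edge_moment_ge0 beta l0) (tilt_ge0 eps lam s d1)) _.
  have e4 := @expR1_le4 R.
  have g12 : g 1%N <= 2.
    have := g1_le; have := c0_le; have := c0_gt0; have := eps_gt0; have := eps_lt1; nra.
  have e16 : expR (g 1%N) <= 16.
    apply: (@le_trans _ _ (expR (1 + 1))); first by rewrite ler_expR; lra.
    by rewrite expRD; have := expR_ge0 (1 : R); nra.
  have -> : c * g 2%N ^+ 2 * (d * expR (d * (g 1%N - 1) + g 1%N)) =
    (c * g 2%N ^+ 2 * expR (d * (g 1%N - 1))) * (expR (g 1%N) * d).
    by rewrite expRD; ring.
  have b0 : 0 <= c * g 2%N ^+ 2 * expR (d * (g 1%N - 1)).
    apply: mulr_ge0; last exact: expR_ge0.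
    by apply: mulr_ge0; [exact: tilt_ge0|exact: sqr_ge0].
  have := ler_pM b0 (mulr_ge0 (expR_ge0 (g 1%N)) (ltW d_gt0)) tilt_small
    (ler_wpM2r (ltW d_gt0) e16).
  have := ler_wpM2r (ltW d_gt0) e4; lra.
have q_ge0 : 0 <= (1 - eps / 4) ^+ s by rewrite exprn_ge0//; have := eps_lt1; lra.
apply: le_trans (ler_wpM2l q_ge0 hD) _.
have d12 : 0 <= 12 * d by rewrite mulr_ge0// ltW.
apply: le_trans (ler_wpM2r d12 (pow_le_expRN s eps01)) _; rewrite mulrC.
rewrite expRN ler_pdivrMr ?expR_gt0//.
have /andP[s1 _] := sx.
have [_ _ h _] := x_bounds.
have x9 : 0 <= x ^+ 9 by rewrite exprn_ge0//; have := x_ge1; lra.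
have y1 : eps / 4 * x ^+ 9 <= eps / 4 * s%:R by rewrite ler_wpM2l//; have := eps_gt0; lra.
have y0 : 0 <= eps / 4 * x ^+ 9 by rewrite mulr_ge0//; have := eps_gt0; lra.
have : expR (eps / 4 * x ^+ 9) <= expR (eps / 4 * s%:R) by rewrite ler_expR.
have := expR_ge_sqr y0.
(* The quadratic lower bound on exp already has order x^18, above 12 d = 12 x^12. *)
have -> : (eps / 4 * x ^+ 9) ^+ 2 / 4 = (eps * x / 8) ^+ 2 * x ^+ 4 * x ^+ 12 by field.
have x4 : 1 <= x ^+ 4 by rewrite exprn_ege1.
have h25 : 24 <= (eps * x / 8) ^+ 2 
  by have h5 : 5 <= eps * x / 8; [lra|nra].
have x12 : 0 <= x ^+ 12 by rewrite exprn_ge0//; have := x_ge1; lra.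
have : 24 * x ^+ 12 <= (eps * x / 8) ^+ 2 * x ^+ 4 * x ^+ 12.
  by rewrite ler_wpM2r//; apply: le_trans h25 _; rewrite ler_peMr// sqr_ge0.
rewrite dx; lra.
Qed.

(** Per spine vertex, 3 is twice the bound on [leaf_mean], and 3/40 is the failing fraction 3/10
    times the rate 1/4 of q0. *)
Lemma large_decay : 3 * expR (- (3 / 40 * eps * s%:R)) <= expR (- x ^+ 8).
Proof.
have /andP[s1 _] := sx; have [_ _ h _] := x_bounds.
have x8 : 1 <= x ^+ 8 by rewrite exprn_ege1.
have e3 : 3 <= expR 2 :> R by have := expR_ge1Dx (2 : R); lra.
apply: le_trans (ler_wpM2r (expR_ge0 _) e3) _; rewrite -expRD ler_expR.
have h1 : 3 / 40 * eps * x ^+ 9 <= 3 / 40 * eps * s%:R.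
  by rewrite ler_wpM2l//; have := eps_gt0; lra.
have h2 : 40 * x ^+ 8 <= eps * x * x ^+ 8 by rewrite ler_wpM2r//; lra.
have e9 : eps * x * x ^+ 8 = eps * x ^+ 9 by ring.
lra.
Qed.

End Large.

Lemma moment_constants : exists d0 : R, 2 <= d0 /\
  forall (d beta : R) (n : nat),
    d0 <= d -> 0 < beta -> beta <= (1 - eps) * beta_c d -> d <= n%:R ->
  exists (s : nat) (lam : R), [/\ s%:R <= lam,
    leaf_mean n (binomial_pmf n (d / n%:R)) (edge_moment beta lam) (tilt d eps lam s) <= 3 / 2,
    (1 - eps / 4) ^+ s * branch_mean n (binomial_pmf n (d / n%:R))
      (edge_moment beta lam) (tilt d eps lam s) <= 1 / 2 &
    3 * expR (- (3 / 40 * eps * s%:R)) <= expR (- (d `^ (2 / 3)))].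
Proof.
have [x02 _ _ _] := x0_bounds.
have x01 : 1 <= x0 by apply: le_trans x02; rewrite ler1n.
have x00 : 0 <= x0 by exact: le_trans x01.
exists (x0 ^+ 12); split.
  by apply: le_trans x02 _; rewrite -[leLHS]expr1 ler_weXn2l.
move=> d beta n d0d b0 ble dn.
have d0 : 0 <= d by apply: le_trans d0d; rewrite exprn_ge0.
(* With this x, d^(3/4) and d^(2/3) are the integer powers x^9 and x^8. The exponent s, of order
   x^9, must exceed x^8 while s log d stays below order d. *)
pose x := d `^ 12^-1.
have xge0 : 0 <= x by exact: powR_ge0.
have dx : d = x ^+ 12.
  by rewrite -powR_mulrn// -powRrM mulVf// powRr1.
have x0x : x0 <= x.
  by rewrite -(@ler_pXn2r _ 12)// ?nnegrE// -?dx.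
have x9 : 1 <= x ^+ 9 by rewrite exprn_ege1// (le_trans x01).
have x9' : 0 <= x ^+ 9 by exact: le_trans x9.
have sx : x ^+ 9 <= (Num.truncn (x ^+ 9)).+1%:R <= 2 * x ^+ 9.
  have /andP[t1 t2] := truncn_itv x9'.
  by rewrite (ltW t2) /= -natr1; lra.
exists (Num.truncn (x ^+ 9)).+1, (c0 * d); split.
- exact: (large_s_le x0x dx sx).
- exact: (large_leaf_mean_le x0x dx b0 ble dn sx).
- exact: (large_branch_mean_le x0x dx b0 ble dn sx).
- have -> : d `^ (2 / 3) = x ^+ 8.
    rewrite dx -!powR_mulrn// -powRrM; congr (_ `^ _); lra.
  exact: (large_decay x0x sx).
Qed.

End MomentAsymptotics.

(** * From the moment bound to the tail probability *)

(** There are l + 1 spine vertices, so fewer than 7 l / 10 successes leave at least 3 (l + 1) / 10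
    failures, each worth a factor q0^s. *)
Lemma few_blocks_decay (R : realType) (eps : R) (s l nb m : nat) (W : 'I_l.+1 -> R) :
  0 < eps < 1 -> (forall k, 1 - eps / 4 <= W k) ->
  1 <= \prod_k (W k / (1 - eps / 4)) * (1 - eps / 4) ^+ nb ->
  (m + nb = l.+1)%N -> m%:R < 7 / 10 * l%:R :> R ->
  1 <= expR (- (3 / 40 * eps * s%:R)) ^+ l.+1 * \prod_k (W k / (1 - eps / 4)) ^+ s.
Proof.
move=> eps01 hW h mnb ml; have /andP[e0 e1] := eps01.
have q0 : 0 <= 1 - eps / 4 by lra.
have W0 k : 0 <= W k / (1 - eps / 4) by rewrite divr_ge0// (le_trans q0).
have prod0 : 0 <= \prod_k (W k / (1 - eps / 4)) ^+ s.
  by apply: prodr_ge0 => k _; exact: exprn_ge0.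
have := exprn_ege1 s h; rewrite exprMn -prodrXl => h'; apply: le_trans h' _.
rewrite mulrC ler_wpM2r// -exprM mulnC exprM.
apply: (@le_trans _ _ (expR (- (eps / 4 * s%:R)) ^+ nb)).
  by rewrite lerXn2r ?nnegrE ?expR_ge0 ?exprn_ge0// pow_le_expRN.
rewrite -!expRM_natl ler_expR.
have mnbR : m%:R + nb%:R = l%:R + 1 :> R by rewrite -natrD mnb natr1.
have nbl : 3 / 10 * (l%:R + 1) <= nb%:R :> R.
  by have l0 : 0 <= l%:R :> R by []; lra.
have es : 0 <= eps / 4 * s%:R by rewrite mulr_ge0//; lra.
by have := ler_wpM2r es nbl; rewrite -natr1; lra.
Qed.

(** Rounding down is compensated by the extra spine vertex: l + 1 >= ln n / sqrt d. Then d^(2/3) =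
    d^(1/6) sqrt d gives the exponent. *)
Lemma decay_le_powR (R : realType) (d : R) (n l : nat) : 0 < d -> (0 < n)%N ->
  l = Num.truncn (ln (n%:R : R) / Num.sqrt d) ->
  expR (- (d `^ (2 / 3))) ^+ l.+1 <= (n%:R : R) `^ (- (d `^ 6^-1)).
Proof.
move=> d0 n0 lE; have n1 : 1 <= n%:R :> R by rewrite ler1n.
have s0 : 0 < Num.sqrt d by rewrite sqrtr_gt0.
rewrite [leRHS]/powR gt_eqF ?(lt_le_trans ltr01 n1)// -expRM_natl ler_expR.
rewrite mulrN mulNr lerN2.
have h : ln n%:R <= l.+1%:R * Num.sqrt d.
  rewrite -ler_pdivrMr// lE ltW//.
  have y0 : 0 <= ln (n%:R : R) / Num.sqrt d by rewrite divr_ge0 ?ln_ge0// ltW.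
  by have /andP[] := truncn_itv y0.
have -> : (2 / 3 : R) = 6^-1 + 2^-1 by lra.
rewrite powRD; last by rewrite gt_eqF//= implybT.
rewrite powR12_sqrt ?(ltW d0)// mulrCA.
by rewrite ler_wpM2l// powR_ge0.
Qed.

Theorem theorem11p4 (R : realType) (eps : R) (eps_gt0 : 0 < eps) :
  exists d0 : R, 1 <= d0 /\
  forall (d beta : R) (n : nat),
    d0 <= d -> 0 < beta -> beta <= (1 - eps) * beta_c d -> d <= n%:R ->
  forall l r : nat,
    l = Num.truncn (ln (n%:R : R) / Num.sqrt d) -> r = l ->
  forall (disp : measure_display) (Om : measurableType disp)
    (P : probability Om R)
    (N : vertex l n r -> {RV P >-> nat})
    (J : {set vertex l n r} -> {RV P >-> R}),
    random_tree_construction d N J ->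
    (P (few_left_blocks d eps beta N J)
       <= ((n%:R : R) `^ (- (d `^ 6^-1)))%:E)%E /\
    (P (few_right_blocks d eps beta N J)
       <= ((n%:R : R) `^ (- (d `^ 6^-1)))%:E)%E.
Proof.
(* For eps >= 1 no beta satisfies 0 < beta <= (1 - eps) beta_c(d). *)
have [eps_lt1|eps_ge1] := ltP eps 1; last first.
  exists 1; split=> // d beta n d1 b0 ble.
  have : (1 - eps) * beta_c d <= 0.
    by rewrite mulr_le0_ge0 ?subr_le0// divr_ge0 ?sqrtr_ge0// (le_trans ler01).
  by move=> /(le_trans ble); rewrite leNgt b0.
have eps01 : 0 < eps < 1 by rewrite eps_gt0.
have [d0 [d0_ge2 H]] := moment_constants eps01.
exists d0; split; first by apply: le_trans d0_ge2; rewrite ler1n.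
move=> d beta n d0d b0 ble dn l r lE rE disp Om P N J tree.
have [s [lam [s_le leaf branch decay]]] := H d beta n d0d b0 ble dn.
have d2 : 2 <= d by exact: le_trans d0d.
have d1 : 1 <= d by apply: le_trans d2; rewrite ler1n.
have d_gt0 : 0 < d by exact: lt_le_trans d1.
have n0 : (0 < n)%N by rewrite -(ltr0n R) (lt_le_trans d_gt0).
have p01 := binomial_ratio01 d1 dn.
set rho := expR (- (3 / 40 * eps * s%:R)) in decay.
have rho0 : 0 <= rho by exact: expR_ge0.
pose W x := Wmax d eps beta (tree_adj (fun u => N u x)) (fun e => J e x) r (@spine l n r).
(* Common to both events: the moment is at most 3 ^ (l + 1), which [decay] absorbs into the powers
   of [rho]. *)
have bound (E : set Om) : measurable E ->
    (forall x, E x -> 1 <= rho ^+ l.+1 * \prod_i (W x i / (1 - eps / 4)) ^+ s) ->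
    (P E <= ((n%:R : R) `^ (- (d `^ 6^-1)))%:E)%E.
  move=> mE hE.
  apply: le_trans (probability_le_moment tree eps01 d1 s_le p01 mE _ hE branch) _.
    exact: exprn_ge0.
  rewrite lee_fin; apply: le_trans (decay_le_powR d_gt0 n0 lE).
  have leaf0 : 0 <= leaf_mean n (binomial_pmf n (d / n%:R)) (edge_moment beta lam) (tilt d eps lam s).
    apply: sumr_ge0 => k _; rewrite mulr_ge0 ?binomial_pmf_ge0//.
    rewrite addr_ge0// mulr_ge0 ?tilt_ge0// mulr_ge0 ?sqr_ge0// exprn_ge0//.
    by apply: edge_moment_ge0; exact: le_trans s_le.
  rewrite -exprMn lerXn2r ?nnegrE ?expR_ge0 ?mulr_ge0//.
  apply: le_trans decay; rewrite mulrC ler_wpM2r//; lra.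
have Wge x i : 1 - eps / 4 <= W x i by exact: Wmax_ge.
have split_card (b : pred 'I_l.+1) : (#|b| + #|[pred j | ~~ b j]| = l.+1)%N.
  by rewrite -[RHS]card_ord -(cardC b).
have q01 : 0 < 1 - eps / 4 <= 1 by apply/andP; split; lra.
split; apply: bound.
- exact: measurable_few_left_blocks.
- move=> x; rewrite /few_left_blocks /= => hx.
  exact: (few_blocks_decay s eps01 (Wge x) (prod_ge_left_nonblocks q01 (Wge x)) (split_card _) hx).
- exact: measurable_few_right_blocks.
- move=> x; rewrite /few_right_blocks /= => hx.
  exact: (few_blocks_decay s eps01 (Wge x) (prod_ge_right_nonblocks q01 (Wge x)) (split_card _) hx).
Qed.
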